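(* Assume the Riemann Hypothesis. Let $\psi(x)=\sum_{n\le x}\Lambda(n)$, where $\Lambda$ is the von Mangoldt function. Let $\epsilon>0$ and suppose there are absolute constants $A,B>1$ such that for every even positive integer $k$, $$\int_{1}^{X} (\psi(x+h) - \psi(x) - h)^k\, dx = \frac{\Gamma(k+1)}{\Gamma(\frac{k}{2}+1) 2^{k/2}} X h^{k/2} \Bigl(\log{\frac{X}{h}}\Bigr)^{k/2} + O\bigl(A^{B^k} X h^{k/2} (\log X)^{k/2 - 1}\bigr)$$ uniformly for $X^\epsilon \leq h \leq X^{1-\epsilon}$. Let $n$ be a positive odd integer, and suppose that $$\int_{1}^{X} (\psi(x+h)-\psi(x)-h)^n\, dx = o\bigl(X h^{n/2} (\log{X})^{n/2}\bigr)$$ uniformly for $X^{\epsilon} \leq h \leq X^{1-\epsilon}$ as $X\to\infty$. Then for some $\epsilon_1 > 0$, $$\int_{1}^{X} (\psi(x+\delta x)-\psi(x)-\delta x)^n\, dx = o\Bigl(X^{n/2+1} \delta^{n/2} \bigl(\log\tfrac{1}{\delta}\bigr)^{n/2}\Bigr)$$ uniformly for $X^{-1 +2\epsilon + 2\epsilon_1} \leq \delta \leq X^{-\epsilon}/2$ as $X\to\infty$.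
   Context: $\Gamma$ is the gamma function; the implied constant in the $O$-term of the even-moment hypothesis is independent of $k$, $X$, $h$. *)

(* Defs.v *)
From HB Require Import structures.
From mathcomp Require Import all_boot all_order all_algebra.
From mathcomp Require Import all_classical all_reals all_analysis.
From mathcomp Require Import complex.

Set Implicit Arguments.
Unset Strict Implicit.
Unset Printing Implicit Defensive.

Import Order.TTheory GRing.Theory Num.Theory.
Import numFieldNormedType.Exports.

Local Open Scope classical_set_scope.
Local Open Scope ring_scope.
Local Open Scope complex_scope.

(* [primes n] lists the distinct prime divisors of [n]; it is a singleton
   [:: p] exactly when n = p ^ m with p prime and 0 < m. *)
Definition von_mangoldt (R : realType) (n : nat) : R :=
  if primes n is [:: p] then ln p%:R else 0.

Definition chebyshev_psi (R : realType) (x : R) : R :=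
  \sum_(1 <= n < (Num.truncn x).+1) von_mangoldt R n.

(* Euler's integral, valid for 0 < s. *)
Definition Gamma (R : realType) (s : R) : R :=
  \int[@lebesgue_measure R]_(t in `]0, +oo[) (t `^ (s - 1) * expR (- t)).

Definition cexp (R : realType) (z : R[i]) : R[i] :=
  (expR (complex.Re z) * cos (complex.Im z))
    +i* (expR (complex.Re z) * sin (complex.Im z)).

(* Seen through a named [numFieldType], R[i] gets the topology of its modulus and the
   normed-space structure over itself. *)
Definition complexField (R : realType) : numFieldType := R[i].

(* The zeta function is determined by its Dirichlet series on 1 < Re s and by
   holomorphy on the complement of {1}; the value at 1 is irrelevant.
   [derivable] is taken over the field R[i], i.e. it is complex
   differentiability. *)
Definition is_riemann_zeta (R : realType) (zeta : complexField R -> complexField R) : Prop :=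
  (forall s : complexField R, 1 < complex.Re s ->
     series (fun n : nat =>
        cexp (- s * (ln (n.+1%:R : R))%:C) : complexField R) @ \oo
       --> zeta s) /\
  (forall s : complexField R, s != 1 -> derivable zeta s 1).

Definition RiemannHypothesis (R : realType) : Prop :=
  exists2 zeta : complexField R -> complexField R, is_riemann_zeta zeta &
    forall s : complexField R, s != 1 -> zeta s = 0 ->
      (forall m : nat, s != - (2 * m.+1)%:R) -> complex.Re s = 1 / 2.

(* F X t = o(G X t) as X tends to infinity, uniformly for t in
   [lo X, hi X]. *)
Definition unif_littleo (R : realType) (lo hi : R -> R) (F G : R -> R -> R)
    : Prop :=
  forall c : R, 0 < c -> \forall X \near +oo,
    forall t : R, lo X <= t <= hi X -> `|F X t| <= c * `|G X t|.

(* Main.v *)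
Require Import Defs.
From HB Require Import structures.
From mathcomp Require Import all_boot all_order all_algebra.
From mathcomp Require Import all_classical all_reals all_analysis.
From mathcomp Require Import measurable_realfun ring lra.

Import Order.TTheory GRing.Theory Num.Theory.
Import numFieldNormedType.Exports.

Local Open Scope classical_set_scope.
Local Open Scope ring_scope.

(* Write f(x, h) = psi(x + h) - psi(x) - h.  For every v,
     f(x, dl x) = f(x, v) - f((1 + dl) x, v - dl x),
   and averaging over v turns the second term into an average over w = v - dl x
   of moments with a fixed increment (Saffari-Vaughan).  With v of size dl X
   this bounds the (n+1)-th moment of f(x, dl x) by O(X s^(n+1)), where
   s = sqrt(dl X ln X).  For the n-th moment, cut [1, X] into M pieces of length
   d = X/M and on [Y, Y + d] take v in [dl (Y + 2d), dl (Y + 3d)], so that w has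
   size dl d and the second term is of size s / sqrt M.  The fixed-increment odd
   moments on each of the M pieces are o(X s^n) by hypothesis, and
     |(a + b)^n - a^n| <= tau (1 + |a|^(n+1)) + K_tau |b|^(n+1)
   controls the difference by the even (n+1)-th moments; choose tau small, then
   M large, then X large.  Only the upper bound in the even-moment hypothesis,
   for the single exponent n + 1, matters, and of psi only its monotonicity. *)

(** * Averaging over the increment *)

Lemma measurable_fun_affine (R : realType) (al be : R) :
  measurable_fun [set: R] (fun x => al * x + be).
Proof.
apply: measurable_funD; last exact: measurable_cst.
by apply: measurable_funM => //; exact: measurable_cst.
Qed.

(** [al] times the pushforward of Lebesgue measure under x |-> al x + be gives every half-open
    interval its length, so by uniqueness it is Lebesgue measure; the change of variables
    follows. *)
Lemma ge0_integral_affine (R : realType) (al be : R) (phi : R -> \bar R) :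
  0 < al -> measurable_fun [set: R] phi -> (forall x, (0 <= phi x)%E) ->
  (\int[@lebesgue_measure R]_x phi (al * x + be)%R =
   (al^-1)%:E * \int[@lebesgue_measure R]_x phi x)%E.
Proof.
move=> al0 mphi phi0.
have al0' : 0 <= al by exact: ltW.
pose f : R -> measurableTypeR R := fun x => al * x + be.
have mf : measurable_fun setT f by exact: measurable_fun_affine.
pose pf : {measure set (measurableTypeR R) -> \bar R} :=
  measure_function_pushforward__canonical__measure_function_Measure
    lebesgue_measure mf.
pose nu := mscale (NngNum al0') pf.
have nuE A : measurable A -> lebesgue_measure A = nu A.
  apply: lebesgue_measure_unique => _ [[a b]] _ <- /=.
  rewrite /nu /mscale /= /pushforward.
  have -> : f @^-1` `]a, b] = `](a - be) / al, (b - be) / al]%classic.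
    apply/seteqP; split => x; rewrite /f /= !in_itv /=.
      by rewrite ltr_pdivrMr// ler_pdivlMr// ltrBlDr lerBrDr mulrC.
    by rewrite ltr_pdivrMr// ler_pdivlMr// ltrBlDr lerBrDr mulrC.
  rewrite !lebesgue_measure_itv /= !lte_fin.
  rewrite ltr_pM2r ?invr_gt0// ltrD2r.
  case: ifP => _; last by rewrite mule0.
  rewrite -!EFinD -EFinM; congr (_%:E); field; exact: lt0r_neq0.
have -> : (\int[@lebesgue_measure R]_x phi x = \int[nu]_x phi x)%E.
  by apply: eq_measure_integral => A mA _; exact: nuE.
rewrite ge0_integral_mscale// muleA -EFinM/= mulVf ?mul1e; last exact: lt0r_neq0.
by rewrite ge0_integral_pushforward// preimage_setT.
Qed.

Section tonelli_sets.
Context (R : realType) (h : R * R -> R).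
Hypotheses (mh : measurable_fun setT h) (h0 : forall z, 0 <= h z).
Notation mu := (@lebesgue_measure R).

(** Cutting [h] off by the indicators of [A] and [B] keeps it nonnegative and measurable on the
    whole plane, so that Tonelli there yields the exchange on A x B. *)
Let hr (A B : set R) (z : R * R) : \bar R :=
  (h z * \1_A z.1 * \1_B z.2)%:E.

Let measurable_hr A B : measurable A -> measurable B ->
  measurable_fun setT (hr A B).
Proof.
move=> mA mB; apply/measurable_EFinP; apply: measurable_funM.
  apply: measurable_funM => //.
  by apply: measurableT_comp => //; exact: measurable_indic.
by apply: measurableT_comp => //; exact: measurable_indic.
Qed.

Let hr_ge0 A B z : (0 <= hr A B z)%E.
Proof. by rewrite lee_fin !mulr_ge0. Qed.

Let hrFE A B x : measurable B ->
  fubini_F mu (hr A B) x = ((fun x => \int[mu]_(y in B) (h (x, y))%:E) \_ A)%E x.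
Proof.
move=> mB; rewrite /fubini_F /patch; case: ifPn => xA.
  rewrite [RHS]integral_mkcond; apply: eq_integral => y _.
  rewrite /hr/= /patch !indicE xA mulr1.
  by case: ifPn => _; rewrite ?mulr1 ?mulr0.
rewrite integral0_eq// => y _.
by rewrite /hr/= indicE (negbTE xA) mulr0 mul0r.
Qed.

Let hrGE A B y : measurable A ->
  fubini_G mu (hr A B) y = ((fun y => \int[mu]_(x in A) (h (x, y))%:E) \_ B)%E y.
Proof.
move=> mA; rewrite /fubini_G /patch; case: ifPn => yB.
  rewrite [RHS]integral_mkcond; apply: eq_integral => x _.
  rewrite /hr/= /patch !indicE yB mulr1.
  by case: ifPn => _; rewrite ?mulr1 ?mulr0.
rewrite integral0_eq// => x _.
by rewrite /hr/= [\1_B _]indicE (negbTE yB) mulr0.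
Qed.

Lemma measurable_partial_integral (B : set R) : measurable B ->
  measurable_fun setT (fun x => \int[mu]_(y in B) (h (x, y))%:E)%E.
Proof.
move=> mB; rewrite (_ : (fun _ => _) = fubini_F mu (hr setT B)).
  by apply: measurable_fun_fubini_tonelli_F => //; exact: measurable_hr.
by apply/funext => x; rewrite hrFE// patch_setT.
Qed.

Lemma tonelli_sets (A B : set R) : measurable A -> measurable B ->
  (\int[mu]_(x in A) \int[mu]_(y in B) (h (x, y))%:E =
   \int[mu]_(y in B) \int[mu]_(x in A) (h (x, y))%:E)%E.
Proof.
move=> mA mB; rewrite [LHS]integral_mkcond [RHS]integral_mkcond.
transitivity (\int[mu]_x fubini_F mu (hr A B) x)%E.
  by apply: eq_integral => x _; rewrite hrFE.
transitivity (\int[mu]_y fubini_G mu (hr A B) y)%E.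
  by apply: fubini_tonelli => //; exact: measurable_hr.
by apply: eq_integral => x _; rewrite hrGE.
Qed.

End tonelli_sets.

(** The integrand cut off to [B] is substituted over the whole line; only an inequality remains
    because the image of [A] may be smaller than [B]. *)
Lemma ge0_integral_affine_le (R : realType) (al be : R) (phi : R -> R)
    (A B : set R) :
  0 < al -> measurable A -> measurable B -> measurable_fun setT phi ->
  (forall x, 0 <= phi x) -> (forall x, A x -> B (al * x + be)) ->
  (\int[@lebesgue_measure R]_(x in A) (phi (al * x + be)%R)%:E <=
   (al^-1)%:E * \int[@lebesgue_measure R]_(x in B) (phi x)%:E)%E.
Proof.
move=> al0 mA mB mphi phi0 AB.
pose phiB (x : R) : \bar R := (phi x * \1_B x)%:E.
have mphiB : measurable_fun setT phiB.
  by apply/measurable_EFinP; apply: measurable_funM.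
have phiB0 x : (0 <= phiB x)%E by rewrite lee_fin mulr_ge0.
have -> : (\int[lebesgue_measure]_(x in B) (phi x)%:E =
           \int[lebesgue_measure]_x phiB x)%E.
  rewrite integral_mkcond; apply: eq_integral => x _.
  by rewrite /patch /phiB indicE; case: ifPn => _; rewrite ?mulr1 ?mulr0.
rewrite -(ge0_integral_affine _ _ be)//.
have mphiBa : measurable_fun setT (fun x => phiB (al * x + be)).
  by apply: measurableT_comp => //; exact: measurable_fun_affine.
apply: (@le_trans _ _ (\int[lebesgue_measure]_(x in A) phiB (al * x + be)%R)%E).
  rewrite le_eqVlt; apply/orP; left; apply/eqP.
  apply: eq_integral => x /[!inE] xA.
  by rewrite /phiB indicE mem_set ?mulr1//; exact: AB.
by apply: ge0_subset_integral => //; exact: measurable_funTS.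
Qed.

(* Since v - dl x runs through a translate of [j1, j2] as v does, Tonelli
   replaces the x-dependent increment by an independent variable w. *)
Lemma averaging (R : realType) (g : R * R -> R) (dl p q j1 j2 w1 w2 c : R)
    (I : set R) :
  measurable_fun setT g -> (forall z, 0 <= g z) -> 0 <= dl ->
  measurable I -> I `<=` `[p, q] -> j1 <= j2 ->
  w1 <= j1 - dl * q -> j2 - dl * p <= w2 -> 0 <= c ->
  (forall v, j1 <= v <= j2 ->
    (c%:E <= \int[@lebesgue_measure R]_(x in I)
       (g ((1 + dl) * x, v - dl * x)%R)%:E)%E) ->
  ((c * (j2 - j1))%:E <= \int[@lebesgue_measure R]_(x in I)
    \int[@lebesgue_measure R]_(w in `[w1, w2]) (g ((1 + dl) * x, w)%R)%:E)%E.
Proof.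
move=> mg g0 dl0 mI Ipq j12 w1j j2w c0 hc.
set mu := @lebesgue_measure R.
pose h (z : R * R) := g ((1 + dl) * z.2, z.1 - dl * z.2).
have h0 z : 0 <= h z by exact: g0.
have mh : measurable_fun setT h.
  apply: measurableT_comp => //; apply/measurable_fun_pair => /=.
    by apply: measurable_funM.
  by apply: measurable_funB => //; apply: measurable_funM.
pose k (z : R * R) := g ((1 + dl) * z.1, z.2).
have k0 z : 0 <= k z by exact: g0.
have mk : measurable_fun setT k.
  apply: measurableT_comp => //; apply/measurable_fun_pair => //=.
  by apply: measurable_funM.
have -> : ((c * (j2 - j1))%:E = \int[mu]_(v in `[j1, j2]) c%:E)%E.
  rewrite integral_cst//= /mu lebesgue_measure_itv/= lte_fin -EFinB.
  move: j12; rewrite le_eqVlt => /predU1P[->|->//].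
  by rewrite ltxx subrr mulr0 mule0.
apply: (@le_trans _ _
    (\int[mu]_(v in `[j1, j2]) \int[mu]_(x in I) (h (v, x))%:E)%E).
  apply: ge0_le_integral => //=.
  by apply: measurable_funTS; exact: (measurable_partial_integral _ h).
rewrite tonelli_sets//; apply: ge0_le_integral => //=.
- by move=> x _; apply: integral_ge0 => v _; rewrite lee_fin.
- apply: measurable_funTS.
  apply: (measurable_partial_integral _ (fun z => h (z.2, z.1))) => //.
  by apply: (measurableT_comp mh); exact/measurable_fun_pair.
- by apply: measurable_funTS; exact: (measurable_partial_integral _ k).
move=> x Ix.
have := @ge0_integral_affine_le R 1 (- (dl * x))
  (fun w => g ((1 + dl) * x, w)) `[j1, j2] `[w1, w2].
rewrite invr1 mul1e /h/=; under eq_integral do rewrite mul1r.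
apply => //=.
- by apply: (measurableT_comp mg); exact/measurable_fun_pair.
move=> v; rewrite !in_itv/= mul1r => /andP[jv vj].
have := Ipq _ Ix; rewrite /= in_itv/= => /andP[px xq].
have := ler_wpM2l dl0 px; have := ler_wpM2l dl0 xq.
by move=> *; apply/andP; split; lra.
Qed.

(** After Tonelli, y = (1 + dl) x maps [1, X] into [1, Z] for each fixed w, and the Jacobian 1 / (1
    + dl) is at most 1; integrating [B] over w gives the factor w2 - w1. *)
Lemma averaged_total (R : realType) (g : R * R -> R) (dl X Z w1 w2 B : R) :
  measurable_fun setT g -> (forall z, 0 <= g z) -> 0 <= dl ->
  (1 + dl) * X <= Z -> w1 <= w2 -> 0 <= B ->
  (forall w, w1 <= w <= w2 ->
    (\int[@lebesgue_measure R]_(y in `[1%R, Z]) (g (y, w))%:E <= B%:E)%E) ->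
  (\int[@lebesgue_measure R]_(x in `[1%R, X])
    \int[@lebesgue_measure R]_(w in `[w1, w2]) (g ((1 + dl) * x, w)%R)%:E
   <= (B * (w2 - w1))%:E)%E.
Proof.
move=> mg g0 dl0 XZ w12 B0 hB.
set mu := @lebesgue_measure R.
pose k (z : R * R) := g ((1 + dl) * z.1, z.2).
have k0 z : 0 <= k z by exact: g0.
have mk : measurable_fun setT k.
  apply: measurableT_comp => //; apply/measurable_fun_pair => //=.
  by apply: measurable_funM.
rewrite (tonelli_sets _ k)//.
have -> : ((B * (w2 - w1))%:E = \int[mu]_(v in `[w1, w2]) B%:E)%E.
  rewrite integral_cst//= /mu lebesgue_measure_itv/= lte_fin -EFinB.
  move: w12; rewrite le_eqVlt => /predU1P[->|->//].
  by rewrite ltxx subrr mulr0 mule0.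
apply: ge0_le_integral => //=.
- by move=> w _; apply: integral_ge0 => v _; rewrite lee_fin.
- apply: measurable_funTS.
  apply: (measurable_partial_integral _ (fun z => k (z.2, z.1))) => //.
  by apply: (measurableT_comp mk); exact/measurable_fun_pair.
move=> w; rewrite in_itv => /hB; apply: le_trans.
have mgw : measurable_fun setT (fun y => g (y, w)).
  by apply: (measurableT_comp mg); exact/measurable_fun_pair.
have dl1 : 0 < 1 + dl by lra.
apply: le_trans.
  have := @ge0_integral_affine_le R (1 + dl) 0
    (fun y => g (y, w)) `[1, X] `[1, Z] dl1.
  rewrite /k/=; under eq_integral do rewrite addr0.
  apply => //= x; rewrite !in_itv/= addr0 => /andP[x1 xX].
  apply/andP; split.
    by rewrite -[1%R in leLHS]mulr1 ler_pM//; lra.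
  by apply: le_trans XZ; rewrite ler_pM2l.
rewrite -[leRHS]mul1e lee_wpmul2r//.
  by apply: integral_ge0 => v _; rewrite lee_fin.
by rewrite lee_fin invf_le1//; lra.
Qed.

(** * Elementary inequalities *)

(** A mean value estimate without derivatives: telescoping pulls out one factor [b] and leaves n - 1
    factors of size at most |a| + |b|. *)
Lemma norm_exprD_sub (R : realFieldType) (n : nat) (a b : R) :
  `|(a + b) ^+ n - a ^+ n| <= n%:R * `|b| * (`|a| + `|b|) ^+ n.-1.
Proof.
elim: n => [|n IH]; first by rewrite !expr0 subrr normr0 mul0r mul0r.
have -> : (a + b) ^+ n.+1 - a ^+ n.+1 =
    (a + b) * ((a + b) ^+ n - a ^+ n) + b * a ^+ n by rewrite !exprS; ring.
apply: (le_trans (ler_normD _ _)); rewrite !normrM normrX /=.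
have ab0 : 0 <= `|a| + `|b| by rewrite addr_ge0.
have h1 : `|a + b| * `|(a + b) ^+ n - a ^+ n|
    <= n%:R * `|b| * (`|a| + `|b|) ^+ n.
  case: n IH => [|n] IH.
    by rewrite !expr0 subrr normr0 mulr0 !mul0r.
  apply: (@le_trans _ _ ((`|a| + `|b|)
      * (n.+1%:R * `|b| * (`|a| + `|b|) ^+ n))).
    by apply: ler_pM => //; exact: ler_normD.
  by rewrite [in leRHS]exprS le_eqVlt; apply/orP; left; apply/eqP; ring.
have h2 : `|b| * `|a| ^+ n <= `|b| * (`|a| + `|b|) ^+ n.
  rewrite ler_wpM2l// lerXn2r// ?nnegrE//.
  by rewrite lerDl.
rewrite -natr1; lra.
Qed.

(** If |b| is at most sg (1 + |a|), the mean value bound carries the factor [sg], chosen small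
    enough to be absorbed by [tau]; otherwise 1 + |a| is below |b| / sg and everything is bounded by
    a power of |b| / sg. The exponent n + 1 is even when n is odd, so even moments can be used. *)
Lemma norm_exprD_sub_le (R : realFieldType) (n : nat) (tau : R) : 0 < tau ->
  exists2 K : R, 0 < K & forall a b : R,
    `|(a + b) ^+ n - a ^+ n| <= tau * (1 + `|a| ^+ n.+1) + K * `|b| ^+ n.+1.
Proof.
move=> tau0; case: n => [|n].
  exists 1 => // a b; rewrite !expr0 subrr normr0.
  by rewrite addr_ge0// mulr_ge0// ?addr_ge0// ltW.
set m := n.+1.
(* The factor 2^n comes from (|a| + |b|)^n <= (2 P)^n, and 2^(n+2) from P^(m+1) <= 2^(m+1) (1 +
   |a|^(m+1)), where P = 1 + |a|. *)
pose D : R := m%:R * 2 ^+ (n + n.+2).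
have D0 : 0 < D by rewrite mulr_gt0// ?exprn_gt0// ltr0n.
pose sg : R := Num.min 1 (tau / D).
have sg0 : 0 < sg by rewrite lt_min ltr01 divr_gt0.
have sg1 : sg <= 1 by rewrite ge_min lexx.
have sgD : D * sg <= tau.
  by rewrite mulrC -ler_pdivlMr// ge_min lexx orbT.
have K0 : 0 < m%:R * (2 / sg) ^+ m.+1.
  by rewrite mulr_gt0// ?ltr0n// exprn_gt0// divr_gt0.
exists (m%:R * (2 / sg) ^+ m.+1) => //.
move=> a b; apply: (le_trans (norm_exprD_sub _ _ _ _)) => /=.
set P := 1 + `|a|.
have P1 : 1 <= P by rewrite lerDl.
have P0 : 0 <= P by lra.
have [bP|Pb] := leP `|b| (sg * P).
  have bP' : `|b| <= P by apply: (le_trans bP); rewrite ler_piMl.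
  have aP : `|a| <= P by rewrite /P lerDr.
  have P2 : P ^+ m.+1 <= 2 ^+ m.+1 * (1 + `|a| ^+ m.+1).
    have [a1|a1] := leP `|a| 1.
      apply: (@le_trans _ _ (2 ^+ m.+1)).
        by rewrite lerXn2r// ?nnegrE// /P; lra.
      by rewrite ler_pMr ?exprn_gt0// lerDl exprn_ge0.
    apply: (@le_trans _ _ ((2 * `|a|) ^+ m.+1)).
      by rewrite lerXn2r// ?nnegrE// ?mulr_ge0// /P; lra.
    by rewrite exprMn ler_wpM2l ?exprn_ge0// lerDr.
  apply: (@le_trans _ _ (m%:R * (sg * P) * (2 * P) ^+ n)).
    rewrite ler_pM// ?mulr_ge0// ?exprn_ge0// ?addr_ge0//.
      by rewrite ler_wpM2l.
    by rewrite lerXn2r// ?nnegrE ?mulr_ge0 ?addr_ge0//; lra.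
  apply: (@le_trans _ _ (m%:R * 2 ^+ n * sg * P ^+ m.+1)).
    rewrite (_ : _ * _ * _ = m%:R * 2 ^+ n * sg * P ^+ m); last first.
      by rewrite exprMn /m exprS; ring.
    rewrite ler_wpM2l ?mulr_ge0 ?exprn_ge0 ?(ltW sg0)//.
    by rewrite ler_weXn2l.
  apply: (@le_trans _ _ (D * sg * (1 + `|a| ^+ m.+1))).
    rewrite (_ : D * sg * _ =
      m%:R * 2 ^+ n * sg * (2 ^+ m.+1 * (1 + `|a| ^+ m.+1))); last first.
      by rewrite /D exprD /m; ring.
    by rewrite ler_wpM2l// ?mulr_ge0 ?exprn_ge0 ?(ltW sg0).
  apply: (@le_trans _ _ (tau * (1 + `|a| ^+ m.+1))).
    by rewrite ler_wpM2r// addr_ge0// exprn_ge0.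
  by rewrite lerDl mulr_ge0 ?exprn_ge0// ltW.
have Pb' : P <= `|b| / sg by rewrite ler_pdivlMr// mulrC ltW.
have ab : `|a| <= `|b| / sg by apply: le_trans Pb'; rewrite /P lerDr.
have bb : `|b| <= `|b| / sg by rewrite ler_pdivlMr// ler_piMr.
apply: (@le_trans _ _ (m%:R * (2 * (`|b| / sg)) ^+ m.+1)).
  move: Pb' ab bb; set t := `|b| / sg => Pb' ab bb.
  have t1 : 1 <= 2 * t by lra.
  apply: (@le_trans _ _ (m%:R * (2 * t) * (2 * t) ^+ n)).
    apply: ler_pM; rewrite ?mulr_ge0 ?exprn_ge0 ?addr_ge0//.
      by rewrite ler_wpM2l//; lra.
    by rewrite lerXn2r// ?nnegrE ?addr_ge0//; lra.
  by rewrite -mulrA ler_wpM2l// -exprS ler_weXn2l.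
rewrite (_ : m%:R * (2 / sg) ^+ m.+1 * _ = m%:R * (2 * (`|b| / sg)) ^+ m.+1).
  by rewrite lerDr mulr_ge0 ?addr_ge0 ?exprn_ge0// ltW.
by rewrite -mulrA -exprMn; congr (_ * _ ^+ _); ring.
Qed.

(** Either tau a >= 1, and one more factor only helps, or a < 1 / tau. This serves on the initial
    segment of [1, X] that is not cut into pieces. *)
Lemma expr_le_succ (R : realFieldType) (n : nat) (tau a : R) : 0 < tau ->
  0 <= a -> a ^+ n <= tau * a ^+ n.+1 + tau ^- n.
Proof.
move=> tau0 a0; have [h|h] := leP 1 (tau * a).
  apply: (@le_trans _ _ (tau * a ^+ n.+1)).
    by rewrite exprS mulrA ler_peMl// exprn_ge0.
  by rewrite lerDl invr_ge0 exprn_ge0// ltW.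
apply: (@le_trans _ _ (tau ^- n)).
  rewrite -exprVn lerXn2r// ?nnegrE ?invr_ge0 ?(ltW tau0)//.
  by rewrite -[_^-1]mul1r ler_pdivlMr// mulrC ltW.
by rewrite lerDr mulr_ge0 ?exprn_ge0// ltW.
Qed.

(** * Locally bounded functions and the Chebyshev function *)

Lemma von_mangoldt_ge0 (R : realType) (n : nat) : 0 <= von_mangoldt R n.
Proof.
rewrite /von_mangoldt; case: (primes n) (@mem_primes ^~ n) => [|p [|? ?]] //.
move=> /(_ p); rewrite inE eqxx => /esym/andP[pp _].
by rewrite ln_ge0// ler1n prime_gt0.
Qed.

Lemma chebyshev_psi_nondecreasing (R : realType) :
  {homo @chebyshev_psi R : x y / x <= y}.
Proof.
move=> x y xy; rewrite /chebyshev_psi.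
have txy : (Num.truncn x <= Num.truncn y)%N by exact: le_truncn.
rewrite [leRHS](big_cat_nat (n := (Num.truncn x).+1))//=.
by rewrite lerDl; apply: sumr_ge0 => i _; exact: von_mangoldt_ge0.
Qed.

(** A class closed under the algebraic operations and containing all nondecreasing functions; it
    supplies every integrability condition on measurable subsets of [1, Y]. *)
Definition loc_bounded (R : realType) (h : R -> R) : Prop :=
  measurable_fun setT h /\
  forall Y, exists B, forall x, 1 <= x <= Y -> `|h x| <= B.

Section loc_bounded.
Context (R : realType).
Implicit Types h : R -> R.
Notation mu := (@lebesgue_measure R).

Lemma loc_bounded_cst (c : R) : loc_bounded R (fun=> c).
Proof. by split=> // Y; exists `|c|. Qed.

Lemma loc_boundedD h1 h2 : loc_bounded R h1 -> loc_bounded R h2 ->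
  loc_bounded R (fun x => h1 x + h2 x).
Proof.
move=> [m1 b1] [m2 b2]; split; first exact: measurable_funD.
move=> Y; have [B1 hB1] := b1 Y; have [B2 hB2] := b2 Y.
exists (B1 + B2) => x xY; rewrite (le_trans (ler_normD _ _))// lerD//.
  exact: hB1.
exact: hB2.
Qed.

Lemma loc_boundedM h1 h2 : loc_bounded R h1 -> loc_bounded R h2 ->
  loc_bounded R (fun x => h1 x * h2 x).
Proof.
move=> [m1 b1] [m2 b2]; split; first exact: measurable_funM.
move=> Y; have [B1 hB1] := b1 Y; have [B2 hB2] := b2 Y.
by exists (B1 * B2) => x xY; rewrite normrM ler_pM ?hB1 ?hB2.
Qed.

Lemma loc_boundedN h : loc_bounded R h -> loc_bounded R (fun x => - h x).
Proof.
move=> hh; have := loc_boundedM _ _ (loc_bounded_cst (-1)) hh.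
by under eq_fun do rewrite mulN1r.
Qed.

Lemma loc_boundedB h1 h2 : loc_bounded R h1 -> loc_bounded R h2 ->
  loc_bounded R (fun x => h1 x - h2 x).
Proof. by move=> ? ?; apply: loc_boundedD => //; exact: loc_boundedN. Qed.

Lemma loc_boundedX h n : loc_bounded R h -> loc_bounded R (fun x => h x ^+ n).
Proof.
move=> [mh bh]; split; first exact: measurable_funX.
move=> Y; have [B hB] := bh Y; exists (B ^+ n) => x xY.
by rewrite normrX lerXn2r// ?nnegrE// ?hB// (le_trans _ (hB _ xY)).
Qed.

Lemma loc_bounded_norm h : loc_bounded R h -> loc_bounded R (fun x => `|h x|).
Proof.
move=> [mh bh]; split; first exact: measurableT_comp.
by move=> Y; have [B hB] := bh Y; exists B => x xY; rewrite normr_id hB.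
Qed.

Lemma nondecreasing_loc_bounded h : {homo h : x y / x <= y} -> loc_bounded R h.
Proof.
move=> hh; split; first exact: nondecreasing_measurable.
move=> Y; exists (`|h 1| + `|h Y|) => x /andP[x1 xY].
have := hh _ _ x1; have := hh _ _ xY => hxY h1x.
rewrite ler_norml; apply/andP; split.
  have := ler_norm (- h 1); rewrite normrN; have := normr_ge0 (h Y); lra.
by have := ler_norm (h Y); have := normr_ge0 (h 1); lra.
Qed.

Lemma loc_bounded_integrable h (I : set R) Y : measurable I ->
  I `<=` `[1, Y] -> loc_bounded R h -> mu.-integrable I (EFin \o h).
Proof.
move=> mI IY [mh bh].
have H := @integrableS _ _ _ mu `[1, Y]%classic I (EFin \o h).
apply: H => //.
apply: measurable_bounded_integrable => //.
- by rewrite /= lebesgue_measure_itv/=; case: ifPn => // _; rewrite -EFinB ltry.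
- exact: measurable_funTS.
have [B hB] := bh Y; exists B; split; first exact: num_real.
move=> M BM x /=; rewrite in_itv/= => /hB xB.
exact: le_trans xB (ltW BM).
Qed.

Lemma loc_bounded_Rintegral_split h (Y Z : R) : loc_bounded R h ->
  1 <= Y -> Y <= Z ->
  \int[mu]_(x in `]Y, Z]) h x =
  \int[mu]_(x in `[1, Z]) h x - \int[mu]_(x in `[1, Y]) h x.
Proof.
move=> hh Y1 YZ; rewrite -(@Rintegral_itvB _ h (BLeft 1) (BRight Z)) ?bnd_simp//.
exact: (loc_bounded_integrable _ _ Z).
Qed.

Lemma loc_bounded_Rintegral_le h (Y Z : R) : loc_bounded R h ->
  (forall x, 0 <= h x) -> 1 <= Y -> Y <= Z ->
  \int[mu]_(x in `[1, Y]) h x <= \int[mu]_(x in `[1, Z]) h x.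
Proof.
move=> hh h0 Y1 YZ; rewrite -subr_ge0 -loc_bounded_Rintegral_split//.
exact: Rintegral_ge0.
Qed.

Lemma loc_bounded_EFin_Rintegral h (I : set R) Y : measurable I ->
  I `<=` `[1, Y] -> loc_bounded R h ->
  (\int[mu]_(x in I) (h x)%:E = (\int[mu]_(x in I) h x)%:E)%E.
Proof.
move=> mI IY hh; rewrite /Rintegral fineK//.
apply: integrable_fin_num => //.
exact: loc_bounded_integrable IY hh.
Qed.

End loc_bounded.

(** * From fixed increments to increments proportional to x *)

(** This is f(x, h) for a general function [p]; the increment precedes the point, so that
    [increment R p h] is a function of x. *)
Definition increment (R : realType) (p : R -> R) (h x : R) : R :=
  p (x + h) - p x - h.

Section increments.
Context (R : realType) (p : R -> R).
Hypothesis ndp : {homo p : x y / x <= y}.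
Notation mu := (@lebesgue_measure R).

(** Both increments on the right end at x + v, and the second starts at x + dl x, where the one on
    the left ends. *)
Lemma increment_split (dl v x : R) :
  increment R p (dl * x) x
  = increment R p v x - increment R p (v - dl * x) ((1 + dl) * x).
Proof.
rewrite /increment.
have -> : (1 + dl) * x + (v - dl * x) = x + v by ring.
have -> : (1 + dl) * x = x + dl * x by ring.
ring.
Qed.

Lemma loc_bounded_increment (h : R) : loc_bounded R (increment R p h).
Proof.
apply: loc_boundedB; last exact: loc_bounded_cst.
apply: loc_boundedB; last exact: nondecreasing_loc_bounded.
by apply: nondecreasing_loc_bounded => x y xy; rewrite ndp// lerD2r.
Qed.

Lemma loc_bounded_increment_mul (dl : R) : 0 <= dl ->
  loc_bounded R (fun x => increment R p (dl * x) x).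
Proof.
move=> dl0; apply: loc_boundedB.
  apply: loc_boundedB; last exact: nondecreasing_loc_bounded.
  apply: nondecreasing_loc_bounded => x y xy; rewrite ndp// lerD// ler_wpM2l//.
by apply: nondecreasing_loc_bounded => x y xy; rewrite ler_wpM2l.
Qed.

Lemma loc_bounded_increment_sub (dl v : R) : 0 <= dl ->
  loc_bounded R (fun x => increment R p (v - dl * x) ((1 + dl) * x)).
Proof.
move=> dl0.
rewrite (_ : (fun _ => _) =
    fun x => increment R p v x - increment R p (dl * x) x); last first.
  by apply/funext => x; rewrite (increment_split dl v x); ring.
apply: loc_boundedB; first exact: loc_bounded_increment.
exact: loc_bounded_increment_mul.
Qed.

Lemma measurable_increment2 (k : nat) :
  measurable_fun setT (fun z : R * R => increment R p z.2 z.1 ^+ k).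
Proof.
have mp : measurable_fun setT p by exact: nondecreasing_measurable.
apply: measurable_funX; apply: measurable_funB; last exact: measurable_snd.
apply: measurable_funB.
  by apply: (measurableT_comp mp); apply: measurable_funD.
by apply: (measurableT_comp mp).
Qed.

(** For v in [2 dl X, 3 dl X] and x in [1, X], w = v - dl x lies in [dl X, 3 dl X]. In (u - b)^k <=
    2^k (u^k + b^k) the fixed increment v contributes [B], and the averaged term 2 B, since the
    w-range is twice as long as the v-range; hence the factor 3. *)
Lemma moment_mul_le (k : nat) (X Z dl B : R) : ~~ odd k ->
  1 <= X -> 0 < dl -> 0 <= B -> (1 + dl) * X <= Z ->
  (forall h, dl * X <= h <= 3 * (dl * X) ->
     \int[mu]_(x in `[1, Z]) increment R p h x ^+ k <= B) ->
  \int[mu]_(x in `[1, X]) increment R p (dl * x) x ^+ k <= 2 ^+ k * (3 * B).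
Proof.
move=> evk X1 dl0 B0 XZ hB.
have dl0' := ltW dl0.
have dX0 : 0 < dl * X by rewrite mulr_gt0//; lra.
have XleZ : X <= Z by apply: le_trans XZ; rewrite mulrDl mul1r lerDl ltW.
set al := \int[mu]_(x in _) _.
(* A lower bound for the k-th moment of the second term of the splitting, valid for every v; the
   maximum with 0 gives the sign that [averaging] requires. *)
pose c := Num.max 0 (al / 2 ^+ k - B).
have k2 : 0 < 2 ^+ k :> R by rewrite exprn_gt0.
suff : c * (dl * X) <= B * (2 * (dl * X)).
  rewrite mulrA ler_pM2r// => cB.
  have : al / 2 ^+ k - B <= B * 2 by apply: le_trans cB; rewrite le_max lexx orbT.
  by rewrite lerBlDr ler_pdivrMr// => /le_trans; apply; rewrite mulrC ler_pM2l//; lra.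
pose g (z : R * R) := increment R p z.2 z.1 ^+ k.
have g0 z : 0 <= g z by exact: exprn_even_ge0.
have mg : measurable_fun setT g by exact: measurable_increment2.
have h1 := averaging R g dl 1 X (2 * (dl * X)) (3 * (dl * X)) (dl * X)
  (3 * (dl * X)) c `[1, X]%classic mg g0 dl0'.
have h2 := averaged_total R g dl X Z (dl * X) (3 * (dl * X)) B mg g0 dl0' XZ.
rewrite -lee_fin (_ : c * (dl * X) = c * (3 * (dl * X) - 2 * (dl * X))); last by ring.
apply: (le_trans (h1 _ _ _ _ _ _ _)) => //; [lra|lra|lra| | |].
- by rewrite le_max lexx.
- move=> v vJ; rewrite (loc_bounded_EFin_Rintegral _ _ _ X)//; last first.
    by apply: loc_boundedX; exact: loc_bounded_increment_sub.
  rewrite lee_fin ge_max; apply/andP; split; first exact: Rintegral_ge0.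
  have Hv : \int[mu]_(x in `[1, X]) increment R p v x ^+ k <= B.
    apply: le_trans (hB v _); last by apply/andP; split; lra.
    apply: loc_bounded_Rintegral_le => //.
      by apply: loc_boundedX; exact: loc_bounded_increment.
    by move=> x; exact: exprn_even_ge0.
  rewrite lerBlDr ler_pdivrMr//.
  set beta := \int[mu]_(x in _) _.
  apply: (@le_trans _ _ (2 ^+ k * (beta
     + \int[mu]_(x in `[1, X]) increment R p v x ^+ k))); last first.
    by rewrite [leRHS]mulrC ler_pM2l// lerD2l.
  rewrite /al /beta -RintegralD//; last 2 first.
  + apply: (loc_bounded_integrable _ _ _ X) => //.
    by apply: loc_boundedX; exact: loc_bounded_increment_sub.
  + apply: (loc_bounded_integrable _ _ _ X) => //.
    by apply: loc_boundedX; exact: loc_bounded_increment.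
  have lbD : loc_bounded R (fun x => increment R p (v - dl * x) ((1 + dl) * x) ^+ k
       + increment R p v x ^+ k).
    apply: loc_boundedD; apply: loc_boundedX; first exact: loc_bounded_increment_sub.
    exact: loc_bounded_increment.
  rewrite -RintegralZl//; last exact: (loc_bounded_integrable _ _ _ X).
  apply: le_Rintegral => //.
  + apply: (loc_bounded_integrable _ _ _ X) => //.
    by apply: loc_boundedX; exact: loc_bounded_increment_mul.
  + apply: (loc_bounded_integrable _ _ _ X) => //.
    by apply: loc_boundedM => //; exact: loc_bounded_cst.
  move=> x _; rewrite /g/= (increment_split dl v x).
  set u := increment _ _ v x; set b := increment _ _ _ (_ * x).
  rewrite -(ger0_norm (exprn_even_ge0 (u - b) evk)) normrX.
  rewrite -(ger0_norm (exprn_even_ge0 u evk)) -(ger0_norm (exprn_even_ge0 b evk)).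
  rewrite !normrX.
  (* The larger of |u| and |b| controls the difference, and its k-th power is one of the two
     summands. *)
  have [ub|ub] := leP `|u| `|b|.
    apply: (@le_trans _ _ ((2 * `|b|) ^+ k)).
      rewrite lerXn2r ?nnegrE ?mulr_ge0//.
      by apply: (le_trans (ler_normB _ _)); lra.
    by rewrite exprMn ler_pM2l// lerDl exprn_ge0.
  apply: (@le_trans _ _ ((2 * `|u|) ^+ k)).
    rewrite lerXn2r ?nnegrE ?mulr_ge0//.
    by apply: (le_trans (ler_normB _ _)); lra.
  by rewrite exprMn ler_pM2l// lerDr exprn_ge0.
- apply: (le_trans (h2 _ _ _)) => //; first lra.
    move=> w wW; rewrite (loc_bounded_EFin_Rintegral _ _ _ Z)//.
      by rewrite lee_fin; exact: hB.
    by apply: loc_boundedX; exact: loc_bounded_increment.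
  by rewrite lee_fin ler_wpM2l//; lra.
Qed.

End increments.

(** * The n-th moment, by cutting [1, X] into short pieces *)

Section piecewise.
Context (R : realType) (p : R -> R).
Hypothesis ndp : {homo p : x y / x <= y}.
Notation mu := (@lebesgue_measure R).

Section pieces.
Variables (n : nat) (dl s tau K : R).
Hypotheses (evn : ~~ odd n.+1) (dl0 : 0 < dl) (s0 : 0 < s) (tau0 : 0 < tau)
  (K0 : 0 < K).
Hypothesis HK : forall a b : R, `|(a + b) ^+ n - a ^+ n| <=
  tau * (s ^+ n + a ^+ n.+1 / s) + K * (b ^+ n.+1 / s).

Let a (x : R) := increment R p (dl * x) x.
Let g (z : R * R) := increment R p z.2 z.1 ^+ n.+1.
Let g0 z : 0 <= g z. Proof. exact: exprn_even_ge0. Qed.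
Let mg : measurable_fun setT g. Proof. exact: measurable_increment2. Qed.
Let lba : loc_bounded R a.
Proof. by apply: loc_bounded_increment_mul => //; exact: ltW. Qed.
Let lban m : loc_bounded R (fun x => a x ^+ m).
Proof. exact: loc_boundedX. Qed.
Let lbE : loc_bounded R (fun x => s ^+ n + a x ^+ n.+1 / s).
Proof.
apply: loc_boundedD; first exact: loc_bounded_cst.
by apply: loc_boundedM; [exact: lban|exact: loc_bounded_cst].
Qed.
(** The right-hand side of [averaging] for the (n+1)-th power. It is additive in [I], so the errors
    of all pieces add up to one integral over a subset of [1, X], to which [averaged_total] applies;
    that bound also provides finiteness. *)
Let G (d : R) (I : set R) : \bar R := (\int[mu]_(x in I)
  \int[mu]_(w in `[(dl * d)%R, (3 * (dl * d))%R]) (g ((1 + dl) * x, w)%R)%:E)%E.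

Let mG (d : R) (D : set R) : measurable_fun D (fun x =>
  \int[mu]_(w in `[(dl * d)%R, (3 * (dl * d))%R]) (g ((1 + dl) * x, w)%R)%:E)%E.
Proof.
pose k (z : R * R) := g ((1 + dl) * z.1, z.2).
have k0 z : 0 <= k z by exact: g0.
apply: measurable_funTS.
apply: (measurable_partial_integral _ k) => //.
apply: (measurableT_comp mg); apply/measurable_fun_pair => //=.
by apply: measurable_funM.
Qed.

Let inner_ge0 (d x : R) : (0 <= \int[mu]_(w in `[(dl * d)%R, (3 * (dl * d))%R])
  (g ((1 + dl) * x, w)%R)%:E)%E.
Proof. by apply: integral_ge0 => w _; rewrite lee_fin. Qed.

Let le_G (d : R) (I J : set R) : measurable I -> measurable J -> I `<=` J ->
  (G d I <= G d J)%E.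
Proof. by move=> mI mJ IJ; apply: ge0_subset_integral => //; exact: mG. Qed.

Let G_fin_num (d : R) (I J : set R) : measurable I -> measurable J ->
  I `<=` J -> (G d J < +oo)%E -> G d I \is a fin_num.
Proof.
move=> mI mJ IJ Joo; rewrite ge0_fin_numE.
  exact: le_lt_trans (le_G _ _ _ mI mJ IJ) Joo.
by apply: integral_ge0 => x _; exact: inner_ge0.
Qed.

(** For these v and for x in ]Y, Y + d], w = v - dl x lies in [dl d, 3 dl d]. The increment v equals
    a + b, with b the second term of the splitting, so [HK] compares its n-th moment with that of a
    for each v. This forces a lower bound on the (n+1)-th moment of b, which averaging over v, a
    range of length dl d, converts into a bound by [G]. *)
Lemma piece_bound (Y d beta : R) : 1 <= Y -> 0 < d ->
  (forall v, dl * (Y + 2 * d) <= v <= dl * (Y + 3 * d) ->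
    `|\int[mu]_(x in `]Y, Y + d]) increment R p v x ^+ n| <= beta) ->
  G d `]Y, Y + d]%classic \is a fin_num ->
  `|\int[mu]_(x in `]Y, Y + d]) a x ^+ n| <= beta
     + tau * (\int[mu]_(x in `]Y, Y + d]) (s ^+ n + a x ^+ n.+1 / s))
     + K / s / (dl * d) * fine (G d `]Y, Y + d]%classic).
Proof.
move=> Y1 d0 hbeta Gfin.
have dl0' := ltW dl0.
have dd0 : 0 < dl * d by rewrite mulr_gt0.
have IY : `]Y, Y + d] `<=` `[1, Y + d].
  move=> x /=; rewrite !in_itv/= => /andP[Yx ->]; rewrite andbT.
  by apply: le_trans Y1 _; exact: ltW.
set al := `|_|; set e := \int[mu]_(x in _) _.
(* [c] does not depend on v but will be a lower bound for
   the (n+1)-th moment of the second term for every admissible v. *)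
pose c := Num.max 0 ((al - beta - tau * e) * (s / K)).
have cle : al <= beta + tau * e + K / s * c.
  have : (al - beta - tau * e) * (s / K) <= c by rewrite le_max lexx orbT.
  rewrite -ler_pdivlMr ?divr_gt0// invf_div mulrC; lra.
apply: (le_trans cle); rewrite lerD2l -[leRHS]mulrA.
rewrite ler_wpM2l ?divr_ge0 ?(ltW K0) ?(ltW s0)//.
rewrite mulrC ler_pdivlMr//.
rewrite -lee_fin fineK//.
have := averaging R g dl Y (Y + d) (dl * (Y + 2 * d)) (dl * (Y + 3 * d))
  (dl * d) (3 * (dl * d)) c `]Y, Y + d]%classic mg g0 dl0'.
rewrite (_ : dl * (Y + 3 * d) - dl * (Y + 2 * d) = dl * d); last by ring.
apply => //.
- by move=> x /=; rewrite !in_itv/= => /andP[/ltW -> ->].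
- by rewrite ler_pM2l// lerD2l; lra.
- by rewrite -mulrBr ler_pM2l//; lra.
- by rewrite -mulrBr (_ : Y + 3 * d - Y = 3 * d); [rewrite mulrCA|ring].
- by rewrite le_max lexx.
move=> v vJ; rewrite (loc_bounded_EFin_Rintegral _ _ _ (Y + d))//; last first.
  by apply: loc_boundedX; exact: loc_bounded_increment_sub.
rewrite lee_fin ge_max; apply/andP; split; first exact: Rintegral_ge0.
set phi := \int[mu]_(x in _) _.
have lbv : loc_bounded R (fun x => increment R p v x ^+ n).
  by apply: loc_boundedX; exact: loc_bounded_increment.
have lbb : loc_bounded R
    (fun x => increment R p (v - dl * x) ((1 + dl) * x) ^+ n.+1).
  by apply: loc_boundedX; exact: loc_bounded_increment_sub.
have lbint h : loc_bounded R h -> mu.-integrable `]Y, Y + d] (EFin \o h).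
  by move=> lbh; exact: (loc_bounded_integrable _ _ _ (Y + d)).
suff : al <= beta + tau * e + K * (phi / s).
  move=> H; rewrite mulrC -ler_pdivlMl ?divr_gt0// invf_div.
  by rewrite mulrAC -mulrA; lra.
have lbK : loc_bounded R (fun x =>
    K * (increment R p (v - dl * x) ((1 + dl) * x) ^+ n.+1 / s)).
  apply: loc_boundedM; first exact: loc_bounded_cst.
  by apply: loc_boundedM => //; exact: loc_bounded_cst.
have lbt : loc_bounded R (fun x => tau * (s ^+ n + a x ^+ n.+1 / s)).
  by apply: loc_boundedM => //; exact: loc_bounded_cst.
have lbdiff : loc_bounded R (fun x => increment R p v x ^+ n - a x ^+ n).
  exact: loc_boundedB.
have -> : tau * e = \int[mu]_(x in `]Y, Y + d]) (tau * (s ^+ n + a x ^+ n.+1 / s)).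
  by rewrite RintegralZl//; exact: lbint.
have -> : K * (phi / s) = \int[mu]_(x in `]Y, Y + d])
    (K * (increment R p (v - dl * x) ((1 + dl) * x) ^+ n.+1 / s)).
  rewrite RintegralZl//; last first.
    by apply: lbint; apply: loc_boundedM => //; exact: loc_bounded_cst.
  by rewrite RintegralZr//; exact: lbint.
rewrite -addrA -RintegralD//; [|exact: lbint|exact: lbint].
have -> : al = `|\int[mu]_(x in `]Y, Y + d]) increment R p v x ^+ n
   - \int[mu]_(x in `]Y, Y + d]) (increment R p v x ^+ n - a x ^+ n)|.
  rewrite RintegralB//; [|exact: lbint|exact: lbint].
  by rewrite /al; congr `|_|; ring.
apply: (le_trans (ler_normB _ _)); apply: lerD; first exact: hbeta.
apply: (le_trans (le_normr_Rintegral _ _)) => //; first exact: lbint.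
apply: le_Rintegral => //.
- by apply: lbint; exact: loc_bounded_norm.
- by apply: lbint; exact: loc_boundedD.
move=> x _ /=; have := HK (a x) (increment R p (v - dl * x) ((1 + dl) * x)).
by rewrite {1}/a {1}(increment_split R p dl v x) subrK.
Qed.

(** Induction on the number of pieces: the two integral terms of [piece_bound] are additive with
    fixed coefficients, and only [beta] is multiplied by the number of pieces. *)
Lemma pieces_bound (Y0 d X beta : R) (j : nat) : 1 <= Y0 -> 0 < d ->
  (forall Y v, Y0 <= Y -> Y + d <= X ->
    dl * (Y + 2 * d) <= v <= dl * (Y + 3 * d) ->
    `|\int[mu]_(x in `]Y, Y + d]) increment R p v x ^+ n| <= beta) ->
  (G d `[1%R, X]%classic < +oo)%E ->
  Y0 + j%:R * d <= X ->
  `|\int[mu]_(x in `]Y0, Y0 + j%:R * d]) a x ^+ n| <= j%:R * beta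
     + tau * (\int[mu]_(x in `]Y0, Y0 + j%:R * d]) (s ^+ n + a x ^+ n.+1 / s))
     + K / s / (dl * d) * fine (G d `]Y0, Y0 + j%:R * d]%classic).
Proof.
move=> Y01 d0 hbeta Goo.
have Gfin (I : set R) : measurable I -> I `<=` `[1, X] -> G d I \is a fin_num.
  by move=> mI IX; apply: G_fin_num IX Goo.
elim: j => [|j IH] jX.
  rewrite !mul0r addr0 set_itv_ge ?bnd_simp ?ltxx// !Rintegral_set0.
  by rewrite /G integral_set0 normr0 mulr0 mulr0 !addr0.
have jX' : Y0 + j%:R * d + d <= X.
  by move: jX; rewrite -natr1 mulrDl mul1r addrA.
have jd0 : 0 <= j%:R * d by rewrite mulr_ge0// ltW.
set Yj := Y0 + j%:R * d in IH jX' *.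
have -> : Y0 + j.+1%:R * d = Yj + d by rewrite -natr1 mulrDl mul1r addrA.
have YjX : Yj <= X by lra.
have Y0Yj : Y0 <= Yj by rewrite lerDl.
have splitR h : loc_bounded R h -> \int[mu]_(x in `]Y0, Yj + d]) h x =
    \int[mu]_(x in `]Y0, Yj]) h x + \int[mu]_(x in `]Yj, Yj + d]) h x.
  by move=> lbh; rewrite !loc_bounded_Rintegral_split//; lra.
have splitG : G d `]Y0, (Yj + d)%R]%classic
    = (G d `]Y0, Yj]%classic + G d `]Yj, (Yj + d)%R]%classic)%E.
  rewrite /G -ge0_integral_setU//; last 2 first.
  - exact: mG.
  - apply/disj_setPS => x [] /=; rewrite !in_itv/= => /andP[_ xY] /andP[Yx _].
    by move: (lt_le_trans Yx xY); rewrite ltxx.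
  by rewrite -itv_bndbnd_setU// bnd_simp//; lra.
rewrite !splitR// splitG fineD; last 2 first.
- apply: Gfin => // x /=; rewrite !in_itv/= => /andP[? ?]; apply/andP; split; lra.
- apply: Gfin => // x /=; rewrite !in_itv/= => /andP[? ?]; apply/andP; split; lra.
have P := piece_bound Yj d beta (le_trans Y01 Y0Yj) d0.
have {}P := P (fun v hv => hbeta Yj v Y0Yj jX' hv).
have {}P : _ := P (Gfin _ _ _).
apply: (le_trans (ler_normD _ _)).
have := lerD (IH YjX) (P _ _); rewrite -natr1.
move=> /(_ _ _)/le_trans; apply => //.
- move=> x /=; rewrite !in_itv/= => /andP[? ?]; apply/andP; split; lra.
- by rewrite le_eqVlt; apply/orP; left; apply/eqP; ring.
Qed.

(** The pieces start at 3 d, because Y >= 3 d makes v <= dl (Y + 3 d) at most 2 dl Y, which keeps v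
    admissible for the moments up to Y. On [1, 3 d] the n-th power is estimated by the (n+1)-th
    through [Hs]; this and the integral of the [tau] term each cost tau A1 / s. The 2 before [K] is
    the length 2 dl d of the w-range divided by dl d. *)
Lemma odd_moment_mul_le (M : nat) (X Z d beta A1 B1 : R) :
  (3 <= M)%N -> 0 < d -> X = M%:R * d -> 1 <= 3 * d -> (1 + dl) * X <= Z ->
  (forall x : R, 0 <= x ->
     x ^+ n <= tau * (x ^+ n.+1 / s) + tau ^- n * s ^+ n) ->
  0 <= beta -> 0 <= B1 ->
  (forall Y v, 3 * d <= Y -> Y + d <= X ->
    dl * (Y + 2 * d) <= v <= dl * (Y + 3 * d) ->
    `|\int[mu]_(x in `]Y, Y + d]) increment R p v x ^+ n| <= beta) ->
  \int[mu]_(x in `[1, X]) a x ^+ n.+1 <= A1 ->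
  (forall w, dl * d <= w <= 3 * (dl * d) ->
     \int[mu]_(x in `[1, Z]) increment R p w x ^+ n.+1 <= B1) ->
  `|\int[mu]_(x in `[1, X]) a x ^+ n| <=
    tau ^- n * s ^+ n * (3 * d) + M%:R * beta + tau * (X * s ^+ n)
    + 2 * tau * (A1 / s) + 2 * K * (B1 / s).
Proof.
move=> M3 d0 XE d1 XZ Hs beta0 B10 hbeta hA hB.
have M3' : 3 <= M%:R :> R by rewrite ler_nat.
have X3 : 3 * d <= X by rewrite XE ler_pM2r.
have dd0 : 0 < dl * d by rewrite mulr_gt0.
have lbint h (I : set R) : measurable I -> I `<=` `[1, X] -> loc_bounded R h ->
   mu.-integrable I (EFin \o h).
  by move=> mI IX lbh; exact: (loc_bounded_integrable _ _ _ X).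
have Gle : (G d `[1%R, X]%classic <= (B1 * (2 * (dl * d)))%:E)%E.
  have := averaged_total R g dl X Z (dl * d) (3 * (dl * d)) B1 mg g0 (ltW dl0) XZ.
  rewrite (_ : 3 * (dl * d) - dl * d = 2 * (dl * d)); last by ring.
  apply => //; first by lra.
  move=> w wW; rewrite (loc_bounded_EFin_Rintegral _ _ _ Z)//.
    by rewrite lee_fin; exact: hB.
  by apply: loc_boundedX; exact: loc_bounded_increment.
have Goo : (G d `[1%R, X]%classic < +oo)%E by apply: le_lt_trans Gle _; rewrite ltry.
(* Since X = M d and M >= 3, exactly M - 3 pieces cover ]3 d, X]. *)
have H := pieces_bound (3 * d) d X beta (M - 3) d1 d0 hbeta Goo.
have XE' : 3 * d + (M - 3)%:R * d = X by rewrite -mulrDl -natrD subnKC.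
rewrite XE' in H; have {H} := H (lexx _).
rewrite loc_bounded_Rintegral_split//.
set A := \int[mu]_(x in _) _; set A3 := \int[mu]_(x in _) _.
set E := \int[mu]_(x in _) _; set Gr := fine _ => H.
have sub3 : `]3 * d, X] `<=` `[1, X].
  by move=> x /=; rewrite !in_itv/= => /andP[? ?]; apply/andP; split; lra.
have even0 (x : R) : 0 <= x ^+ n.+1 by exact: exprn_even_ge0.
have lbk : loc_bounded R (fun x => a x ^+ n.+1 / s).
  by apply: loc_boundedM => //; exact: loc_bounded_cst.
have intc (Y c : R) : 1 <= Y -> \int[mu]_(x in `[1, Y]) c <= c * Y - c.
  move=> Y1; rewrite Rintegral_cst//= lebesgue_measure_itv/= lte_fin -EFinB.
  move: Y1; rewrite le_eqVlt => /predU1P[<-|->/=].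
    by rewrite ltxx /= mulr0 mulr1 subrr.
  by rewrite mulrBr mulr1.
have kint : \int[mu]_(x in `[1, X]) (a x ^+ n.+1 / s) <= A1 / s.
  rewrite RintegralZr//; last exact: lbint.
  by rewrite ler_pM2r// invr_gt0.
have sn0 : 0 < s ^+ n by rewrite exprn_gt0.
have tn0 : 0 < tau ^- n by rewrite invr_gt0 exprn_gt0.
have hE : E <= X * s ^+ n + A1 / s.
  apply: (@le_trans _ _ (\int[mu]_(x in `[1, X]) (s ^+ n + a x ^+ n.+1 / s))).
    rewrite /E loc_bounded_Rintegral_split// gerBl.
    apply: Rintegral_ge0 => x _.
    by rewrite addr_ge0 ?(ltW sn0)// divr_ge0// ltW.
  rewrite RintegralD//; [|exact/lbint/loc_bounded_cst|exact: lbint].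
  apply: lerD => //; apply: le_trans (intc _ _ _) _; first lra.
  by rewrite mulrC gerBl ltW.
have hG : K / s / (dl * d) * Gr <= 2 * K * (B1 / s).
  have : Gr <= B1 * (2 * (dl * d)).
    rewrite -lee_fin /Gr fineK.
      by apply: le_trans Gle; exact: le_G.
    exact: G_fin_num sub3 Goo.
  move=> GB; apply: (@le_trans _ _ (K / s / (dl * d) * (B1 * (2 * (dl * d))))).
    by rewrite ler_wpM2l// !divr_ge0// ltW.
  rewrite le_eqVlt; apply/orP; left; apply/eqP; field.
  by rewrite !lt0r_neq0.
have hA3 : `|A3| <= tau * (A1 / s) + tau ^- n * s ^+ n * (3 * d).
  apply: (le_trans (le_normr_Rintegral _ _)) => //.
    by apply: (loc_bounded_integrable _ _ _ (3 * d)).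
  apply: (@le_trans _ _ (\int[mu]_(x in `[1, (3 * d)])
      (tau * (a x ^+ n.+1 / s) + tau ^- n * s ^+ n))).
    apply: le_Rintegral => //.
    - by apply: (loc_bounded_integrable _ _ _ (3 * d)) => //; exact: loc_bounded_norm.
    - apply: (loc_bounded_integrable _ _ _ (3 * d)) => //.
      by apply: loc_boundedD; [apply: loc_boundedM => //|]; exact: loc_bounded_cst.
    move=> x _; rewrite normrX -(ger0_norm (even0 (a x))) normrX.
    exact: Hs.
  rewrite RintegralD//; last 2 first.
  - apply: (loc_bounded_integrable _ _ _ (3 * d)) => //.
    by apply: loc_boundedM => //; exact: loc_bounded_cst.
  - by apply: (loc_bounded_integrable _ _ _ (3 * d)) => //; exact: loc_bounded_cst.
  apply: lerD; last first.
    by apply: le_trans (intc _ _ d1) _; rewrite gerBl mulr_ge0// ltW.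
  rewrite RintegralZl//; last by apply: (loc_bounded_integrable _ _ _ (3 * d)).
  rewrite ler_pM2l//; apply: le_trans kint.
  apply: loc_bounded_Rintegral_le => // x; first by rewrite divr_ge0// ltW.
have : `|A| <= `|A - A3| + `|A3| by rewrite -[in leLHS](subrK A3 A) ler_normD.
have hM : (M - 3)%:R * beta <= M%:R * beta by rewrite ler_wpM2r// ler_nat leq_subr.
have htE : tau * E <= tau * (X * s ^+ n + A1 / s) by rewrite ler_pM2l.
lra.
Qed.

End pieces.
End piecewise.

(** * Ranges of the increments *)

(** For 1 <= h <= X one has 0 <= ln (X / h) <= ln X, and ln X >= 1 allows the exponent m - 1 in the
    error to be raised to m; so main term and error are both at most a constant, depending on m,
    times X (h ln X)^m. *)
Lemma even_moment_le (R : realType) (p : R -> R) (eps : R) (eps_gt0 : 0 < eps)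
    (c : nat -> R)
    (even_moments : exists A B C : R, [/\ 1 < A, 1 < B &
      \forall X \near +oo, forall (k : nat) (h : R),
        (0 < k)%N -> ~~ odd k ->
        X `^ eps <= h <= X `^ (1 - eps) ->
        `| \int[@lebesgue_measure R]_(x in `[1, X]) increment R p h x ^+ k
           - c k * X * h `^ (k%:R / 2) * ln (X / h) `^ (k%:R / 2) |
        <= C * (A `^ (B ^+ k) * X * h `^ (k%:R / 2)
                * ln X `^ (k%:R / 2 - 1))])
    (m : nat) : (0 < m)%N ->
  exists2 C0 : R, 0 < C0 & \forall X \near +oo, forall h : R,
    X `^ eps <= h <= X `^ (1 - eps) ->
    \int[@lebesgue_measure R]_(x in `[1, X]) increment R p h x ^+ m.*2
      <= C0 * (X * (h * ln X) ^+ m).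
Proof.
move=> m0; case: even_moments => A [B [C [A1 B1 HX]]].
pose K := A `^ (B ^+ m.*2).
(* The absolute values cover either sign of the coefficient and of [C], and the 1 makes the constant
   positive. *)
exists (`|c m.*2| + `|C| * K + 1).
  by rewrite ltr_pwDr// addr_ge0// mulr_ge0// powR_ge0.
move: HX; apply: filter_app; near=> X => HX h hX.
have Xe : expR 1 <= X by near: X; exact: nbhs_pinfty_ge.
have X1 : 1 <= X by apply: le_trans Xe; rewrite -[leLHS]expR0 ler_expR.
have X0 : 0 < X by lra.
have L1 : 1 <= ln X by rewrite -[leLHS](@expRK R 1) ler_ln// posrE// expR_gt0.
have [hlo hhi] := andP hX.
have h1 : 1 <= h.
  by apply: le_trans hlo; rewrite -[leLHS](powRr0 X) ler_powR// ltW.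
have hX' : h <= X.
  apply: (le_trans hhi); rewrite -[leRHS](powRr1 (ltW X0)) ler_powR//.
  by rewrite gerBl ltW.
have k2 : m.*2%:R / 2 = m%:R :> R.
  by rewrite -muln2 natrM mulfK.
have := HX m.*2 h; rewrite double_gt0 odd_double k2 => /(_ m0 isT hX).
have h0 : 0 <= h by lra.
have LXh0 : 0 <= ln (X / h) by rewrite ln_ge0// ler_pdivlMr ?mul1r//; lra.
have LXh : ln (X / h) <= ln X.
  rewrite ler_ln ?posrE ?divr_gt0//; [|lra].
  by rewrite ler_pdivrMr ?ler_peMr//; lra.
rewrite !powR_mulrn//.
set I := \int[_]_(x in _) _ => HI.
have hm0 : 0 <= h ^+ m by rewrite exprn_ge0.
have Lm0 : 0 <= ln X ^+ m by rewrite exprn_ge0//; lra.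
have Lm1 : ln X `^ (m%:R - 1) <= ln X ^+ m.
  by rewrite -powR_mulrn; [rewrite ler_powR// gerBl|lra].
have T1 : c m.*2 * X * h ^+ m * ln (X / h) ^+ m
    <= `|c m.*2| * (X * (h * ln X) ^+ m).
  rewrite exprMn -!mulrA; apply: (@le_trans _ _
      (`|c m.*2| * (X * (h ^+ m * ln (X / h) ^+ m)))).
    rewrite ler_wpM2r ?ler_norm// mulr_ge0 ?(ltW X0)// mulr_ge0//.
    by rewrite exprn_ge0.
  rewrite ler_wpM2l// ler_wpM2l ?(ltW X0)// ler_wpM2l//.
  by rewrite lerXn2r// nnegrE; lra.
have T2 : C * (K * X * h ^+ m * ln X `^ (m%:R - 1))
    <= `|C| * K * (X * (h * ln X) ^+ m).
  have K0 : 0 <= K by exact: powR_ge0.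
  rewrite exprMn -!mulrA; apply: (@le_trans _ _
      (`|C| * (K * (X * (h ^+ m * ln X `^ (m%:R - 1)))))).
    rewrite ler_wpM2r ?ler_norm// mulr_ge0// mulr_ge0 ?(ltW X0)// mulr_ge0//.
    exact: powR_ge0.
  by rewrite ler_wpM2l// ler_wpM2l// ler_wpM2l ?(ltW X0)// ler_wpM2l.
have T3 : 0 <= X * (h * ln X) ^+ m.
  by rewrite mulr_ge0 ?(ltW X0)// exprMn mulr_ge0.
have := ler_norm (I - c m.*2 * X * h ^+ m * ln (X / h) ^+ m).
rewrite !mulrDl mul1r -/K in HI *; lra.
Unshelve. all: by end_near.
Qed.

Section delta_range.
Context (R : realType) (eps eps1 X dl M : R).
Hypotheses (eps0 : 0 < eps) (eps_small : eps <= 1 / 2) (eps10 : 0 <= eps1)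
  (X1 : 1 <= X) (M3 : 3 <= M) (XM : 4 `^ eps * M <= X `^ eps)
  (dl_lo : X `^ (- 1 + 2 * eps + 2 * eps1) <= dl)
  (dl_hi : dl <= X `^ (- eps) / 2).

Let X0 : 0 < X. Proof. exact: lt_le_trans ltr01 X1. Qed.

Lemma delta_gt0 : 0 < dl.
Proof. by apply: lt_le_trans dl_lo; exact: powR_gt0. Qed.

Lemma delta_le : dl <= 1 / 2.
Proof.
apply: (le_trans dl_hi); rewrite ler_pM2r// -[leRHS](powRr0 X) ler_powR//.
by rewrite oppr_le0 ltW.
Qed.

(** The lower limit for [dl] gives dl X >= X^(2 eps): one factor X^eps is kept, the other absorbs
    4^eps M. *)
Lemma delta_mul_ge : (4 * X) `^ eps <= dl * (X / M).
Proof.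
have M0 : 0 < M by exact: lt_le_trans M3.
rewrite powRM ?(ltW X0)// mulrA ler_pdivlMr// mulrAC.
apply: (@le_trans _ _ (X `^ eps * X `^ eps)).
  by rewrite ler_wpM2r ?powR_ge0.
apply: (@le_trans _ _ (X `^ (- 1 + 2 * eps + 2 * eps1) * X)).
  rewrite -[X in _ <= _ * X](powRr1 (ltW X0)) -!powRD ?(gt_eqF X0) ?implybT//.
  by rewrite ler_powR//; have := eps10; lra.
by rewrite ler_wpM2r ?(ltW X0).
Qed.

(** Here dl X <= X^(1 - eps) / 2, and passing from X to 4 X gains 4^(1 - eps) >= 2, more than the
    remaining 3/2. *)
Lemma delta_mul_le : 3 * (dl * X) <= (4 * X) `^ (1 - eps).
Proof.
have h4 : 2 <= 4 `^ (1 - eps) :> R.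
  apply: (@le_trans _ _ (4 `^ (2^-1))); last first.
    by rewrite ler_powR//; [lra|have := eps_small; lra].
  rewrite powR12_sqrt//.
  by rewrite (_ : 4 = 2 ^+ 2 :> R) ?sqrtr_sqr ?ger0_norm// -natrX.
have dX : dl * X <= X `^ (1 - eps) / 2.
  apply: (@le_trans _ _ (X `^ (- eps) / 2 * X)); first by rewrite ler_wpM2r ?(ltW X0).
  rewrite mulrAC -[X in _ * X / _](powRr1 (ltW X0)) -powRD ?(gt_eqF X0) ?implybT//.
  by rewrite addrC.
have Xp : 0 <= X `^ (1 - eps) by exact: powR_ge0.
rewrite powRM ?(ltW X0)//.
by apply: (@le_trans _ _ (2 * X `^ (1 - eps))); [lra|rewrite ler_wpM2r].
Qed.

(** The factor 1/2 in the upper limit for [dl] cancels the 2, and X^(-eps) <= Y^(-eps). *)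
Lemma delta_mul_sub_le (Y : R) : 0 < Y -> Y <= X -> 2 * (dl * Y) <= Y `^ (1 - eps).
Proof.
move=> Y0 YX.
rewrite powRD; last by rewrite (gt_eqF Y0) implybT.
rewrite powRr1 ?(ltW Y0)// mulrA [leRHS]mulrC ler_wpM2r ?(ltW Y0)//.
apply: (@le_trans _ _ (X `^ (- eps))); first by have := dl_hi; lra.
rewrite !powRN lef_pV2 ?posrE ?powR_gt0//.
by rewrite ge0_ler_powR ?nnegrE ?(ltW Y0) ?(ltW X0) ?(ltW eps0).
Qed.

End delta_range.

(** * Choice of tau and of the number of pieces *)

(** [M] is fixed before X, dl and s. The parameter t measures how short the increments are: t = 1
    bounds the (n+1)-th moment of f(x, dl x), and t = 1 / M that of the second term. The [tau]
    terms, the terms of order 1 / M and the M pieces contribute at most c / 8 each. *)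
Lemma odd_moment_mul_lt (R : realType) (p : R -> R) (C2 c : R) (m : nat) :
  let n := m.*2.+1 in {homo p : x y / x <= y} -> 0 < C2 -> 0 < c ->
  exists2 M : nat, (3 <= M)%N & forall X dl s : R,
    M%:R <= X -> 0 < dl -> dl <= 1 -> 0 < s ->
    (forall t h : R, 0 < t -> t <= 1 ->
      dl * (X / M%:R) <= h <= 3 * (dl * X * t) ->
      \int[@lebesgue_measure R]_(x in `[1, (4 * X)]) increment R p h x ^+ n.+1
        <= C2 * t * (X * s ^+ n * s)) ->
    (forall Y v : R, 3 * (X / M%:R) <= Y -> Y + X / M%:R <= X ->
      dl * (Y + 2 * (X / M%:R)) <= v <= dl * (Y + 3 * (X / M%:R)) ->
      `|\int[@lebesgue_measure R]_(x in `]Y, Y + X / M%:R])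
          increment R p v x ^+ n| <= c / (8 * M%:R) * (X * s ^+ n)) ->
    `|\int[@lebesgue_measure R]_(x in `[1, X])
        increment R p (dl * x) x ^+ n| <= c * (X * s ^+ n).
Proof.
move=> n ndp C20 c0; set mu := @lebesgue_measure R.
pose C1 : R := 2 ^+ n.+1 * (3 * C2).
have C10 : 0 < C1 by rewrite mulr_gt0 ?exprn_gt0// mulr_gt0.
have [tau tau0 tauE] : exists2 tau : R, 0 < tau & tau * (1 + 2 * C1) = c / 8.
  have C10' : 0 < 1 + 2 * C1 by rewrite addr_gt0// mulr_gt0.
  exists (c / 8 / (1 + 2 * C1)); first by rewrite divr_gt0// divr_gt0.
  by rewrite mulfVK// lt0r_neq0.
have [K K0 HK] := norm_exprD_sub_le R n tau tau0.
have tn0 : 0 < tau ^- n by rewrite invr_gt0 exprn_gt0.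
(* M >= q brings the second term, 2 K C2 / M, and the initial segment, 3 tau^(-n) / M, together
   below c / 8. *)
pose q : R := (2 * K * C2 + 3 * tau ^- n) * (8 / c).
have q0 : 0 < q.
  by rewrite mulr_gt0 ?divr_gt0// addr_gt0// ?mulr_gt0.
have [M Mq M3n] : exists2 M : nat, q <= M%:R & (3 <= M)%N.
  exists (maxn 3 (Num.truncn q).+1); last exact: leq_maxl.
  apply: (@le_trans _ _ (Num.truncn q).+1%:R); first exact/ltW/truncnS_gt.
  by rewrite ler_nat leq_maxr.
have M3 : 3 <= M%:R :> R by rewrite ler_nat.
have M0 : 0 < M%:R :> R by apply: lt_le_trans M3.
have M1 : 1 <= M%:R :> R by rewrite ler1n (leq_trans _ M3n).
exists M => // X dl s XMM dl0 dl1 s0 HB hbeta.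
have X1 : 1 <= X by exact: le_trans XMM.
have X0 : 0 < X by exact: lt_le_trans X1.
move: hbeta HB; set d := X / M%:R => hbeta HB.
have d0 : 0 < d by rewrite divr_gt0.
have XE : X = M%:R * d by rewrite mulrC mulfVK// lt0r_neq0.
have d1 : 1 <= 3 * d.
  have d1 : 1 <= d by rewrite ler_pdivlMr// mul1r.
  lra.
have dX : d <= X by rewrite XE ler_peMl ?(ltW d0).
have dldX : dl * d <= dl * X by rewrite ler_pM2l.
have sn0 : 0 < s ^+ n by rewrite exprn_gt0.
have XZ : (1 + dl) * X <= 4 * X by rewrite ler_pM2r//; lra.
pose A1 := C1 * (X * s ^+ n * s).
pose B1 := C2 / M%:R * (X * s ^+ n * s).
pose beta := c / (8 * M%:R) * (X * s ^+ n).
have XSs : 0 < X * s ^+ n * s by rewrite mulr_gt0// mulr_gt0.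
have hA : \int[mu]_(x in `[1, X]) increment R p (dl * x) x ^+ n.+1 <= A1.
  rewrite /A1 /C1 -mulrA -mulrA; apply: (moment_mul_le _ _ ndp _ _ (4 * X)) => //.
  - by rewrite /= odd_double.
  - by rewrite mulr_ge0// ltW.
  move=> h /andP[hlo hhi]; rewrite -[C2]mulr1; apply: HB => //.
  by rewrite (le_trans dldX hlo)/= mulr1.
have hB (w : R) : dl * d <= w <= 3 * (dl * d) ->
    \int[mu]_(x in `[1, (4 * X)]) increment R p w x ^+ n.+1 <= B1.
  move=> wd; apply: HB; rewrite ?invr_gt0//.
    by rewrite invf_le1.
  by rewrite -(mulrA dl X).
have evn : ~~ odd n.+1 by rewrite /= odd_double.
have even0 (x : R) : 0 <= x ^+ n.+1 by exact: exprn_even_ge0.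
(* The inequality is applied to x / s and y / s and multiplied by s^n; the absolute values disappear
   because n + 1 is even. *)
have HK' (x y : R) : `|(x + y) ^+ n - x ^+ n| <=
    tau * (s ^+ n + x ^+ n.+1 / s) + K * (y ^+ n.+1 / s).
  have e1 : (x / s + y / s) ^+ n - (x / s) ^+ n
      = ((x + y) ^+ n - x ^+ n) / s ^+ n by rewrite -mulrDl !expr_div_n mulrBl.
  have e2 z : `|z / s| ^+ n.+1 = z ^+ n.+1 / s ^+ n.+1.
    by rewrite -normrX expr_div_n ger0_norm// divr_ge0 ?even0.
  have := HK (x / s) (y / s); rewrite e1 !e2 normrM.
  rewrite [X in _ * X <= _]ger0_norm ?invr_ge0 ?(ltW sn0)//.
  rewrite ler_pdivrMr// => /le_trans; apply.
  rewrite le_eqVlt; apply/orP; left; apply/eqP; rewrite [s ^+ n.+1]exprS; field.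
  by rewrite lt0r_neq0// lt0r_neq0.
have Hs (x : R) : 0 <= x ->
    x ^+ n <= tau * (x ^+ n.+1 / s) + tau ^- n * s ^+ n.
  move=> x0; have := expr_le_succ R n tau (x / s) tau0.
  rewrite divr_ge0 ?(ltW s0)// => /(_ isT).
  rewrite !expr_div_n ler_pdivrMr// => /le_trans; apply.
  rewrite le_eqVlt; apply/orP; left; apply/eqP; rewrite [s ^+ n.+1]exprS; field.
  by rewrite expf_neq0 ?lt0r_neq0.
have beta0 : 0 <= beta.
  by rewrite mulr_ge0 ?divr_ge0 ?mulr_ge0 ?(ltW c0) ?(ltW X0) ?(ltW sn0).
have B10 : 0 <= B1 by rewrite mulr_ge0 ?divr_ge0 ?(ltW C20) ?(ltW XSs).
have := odd_moment_mul_le R p ndp n dl s tau K evn dl0 s0 tau0 K0 HK'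
  M X (4 * X) d beta A1 B1 M3n d0 XE d1 XZ Hs beta0 B10 hbeta hA hB.
move=> /le_trans; apply.
set W := X * s ^+ n.
have W0 : 0 < W by rewrite mulr_gt0.
have -> : tau ^- n * s ^+ n * (3 * d) = 3 * tau ^- n / M%:R * W.
  by rewrite /d /W; field; rewrite expf_neq0 ?lt0r_neq0.
have -> : M%:R * beta = c / 8 * W.
  by rewrite /beta /W; field; rewrite lt0r_neq0.
have -> : A1 / s = C1 * W by rewrite /A1 /W; field; rewrite lt0r_neq0.
have -> : B1 / s = C2 / M%:R * W by rewrite /B1 /W; field; rewrite !lt0r_neq0.
have hq : 3 * tau ^- n / M%:R + 2 * K * (C2 / M%:R) <= c / 8.
  rewrite (_ : _ + _ = (2 * K * C2 + 3 * tau ^- n) / M%:R); last by ring.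
  rewrite ler_pdivrMr//; have := Mq; rewrite /q.
  by rewrite -ler_pdivlMr ?divr_gt0// invf_div [M%:R * _]mulrC.
have : (3 * tau ^- n / M%:R + 2 * K * (C2 / M%:R)) * W <= c / 8 * W.
  by rewrite ler_pM2r.
have : (tau * (1 + 2 * C1)) * W = c / 8 * W by rewrite tauE.
have : 0 < c * W by rewrite mulr_gt0.
rewrite -/W; lra.
Qed.

(** * The moment hypotheses in the ranges required *)

Section transfer_bounds.
Context (R : realType) (p : R -> R) (eps eps1 X dl : R) (m M : nat).
Hypotheses (ndp : {homo p : x y / x <= y})
  (eps0 : 0 < eps) (eps_small : eps <= 1 / 2) (eps10 : 0 <= eps1)
  (M3 : 3 <= M%:R :> R) (X4 : 4 <= X) (Xe : expR 1 <= X)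
  (XM : 4 `^ eps * M%:R <= X `^ eps)
  (dl_lo : X `^ (- 1 + 2 * eps + 2 * eps1) <= dl)
  (dl_hi : dl <= X `^ (- eps) / 2).
Notation mu := (@lebesgue_measure R).

Let n := m.*2.+1.
Let d := X / M%:R.
(** The size expected of f(x, dl x); with n = 2 m + 1, (dl X ln X)^(m+1) is s^(n+1). *)
Let s := Num.sqrt (dl * X * ln X).
Let X1 : 1 <= X. Proof. by apply: le_trans X4; rewrite ler1n. Qed.
Let X0 : 0 < X. Proof. exact: lt_le_trans X1. Qed.
Let L1 : 1 <= ln X.
Proof. by rewrite -[leLHS](@expRK R 1) ler_ln// posrE// expR_gt0. Qed.
Let L0 : 0 < ln X. Proof. exact: lt_le_trans L1. Qed.
Let dl0 : 0 < dl. Proof. exact: delta_gt0 dl_lo. Qed.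
Let M0 : 0 < M%:R :> R. Proof. exact: lt_le_trans M3. Qed.
Let d0 : 0 < d. Proof. exact: divr_gt0. Qed.
Let dlX0 : 0 < dl * X. Proof. exact: mulr_gt0. Qed.
Let t0 : 0 < dl * X * ln X. Proof. exact: mulr_gt0. Qed.
Let s0 : 0 < s. Proof. by rewrite sqrtr_gt0. Qed.
Let s2 : s ^+ 2 = dl * X * ln X. Proof. by rewrite sqr_sqrtr// ltW. Qed.

(** X >= 4 gives ln (4 X) <= 2 ln X, so h ln (4 X) <= 6 t s^2; in the (m+1)-th power, t^(m+1) is
    weakened to t. *)
Lemma even_moment_at_4X (C0 t h : R) : 0 <= C0 ->
  (forall h, (4 * X) `^ eps <= h <= (4 * X) `^ (1 - eps) ->
    \int[mu]_(x in `[1, (4 * X)]) increment R p h x ^+ n.+1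
      <= C0 * (4 * X * (h * ln (4 * X)) ^+ m.+1)) ->
  0 < t -> t <= 1 -> dl * d <= h <= 3 * (dl * X * t) ->
  \int[mu]_(x in `[1, (4 * X)]) increment R p h x ^+ n.+1
    <= 4 * 6 ^+ m.+1 * C0 * t * (X * s ^+ n * s).
Proof.
move=> C00 HX t00 t1 /andP[hlo hhi].
have h0 : 0 <= h by apply: le_trans hlo; rewrite mulr_ge0 ?(ltW dl0) ?(ltW d0).
have dld := delta_mul_ge R eps eps1 X dl M%:R eps10 X1 M3 XM dl_lo.
have dlX := delta_mul_le R eps X dl eps_small X1 dl_hi.
have hr : (4 * X) `^ eps <= h <= (4 * X) `^ (1 - eps).
  apply/andP; split; first exact: le_trans hlo.
  apply: le_trans dlX; apply: (le_trans hhi); rewrite ler_pM2l//.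
  by rewrite ler_piMr// ltW.
apply: (le_trans (HX _ hr)).
have L4 : ln (4 * X) <= 2 * ln X.
  by rewrite lnM ?posrE// mulrDl mul1r lerD2r ler_ln// posrE.
have L40 : 0 <= ln (4 * X) by rewrite ln_ge0// -[leLHS]mulr1 ler_pM// ler1n.
have hL : (h * ln (4 * X)) ^+ m.+1 <= 6 ^+ m.+1 * t * (s ^+ n * s).
  apply: (@le_trans _ _ ((6 * t * (dl * X * ln X)) ^+ m.+1)).
    have hL1 : h * ln (4 * X) <= 6 * t * (dl * X * ln X).
      rewrite (_ : 6 * t * _ = 3 * (dl * X * t) * (2 * ln X)); last by ring.
      exact: ler_pM.
    have hL0 : 0 <= h * ln (4 * X) by exact: mulr_ge0.
    by rewrite lerXn2r ?nnegrE// (le_trans hL0).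
  have sk : (dl * X * ln X) ^+ m.+1 = s ^+ n * s.
    by rewrite -s2 -exprM mul2n -exprSr /n doubleS.
  rewrite exprMn sk exprMn ler_wpM2r ?mulr_ge0 ?exprn_ge0 ?(ltW s0)//.
  by rewrite ler_wpM2l ?exprn_ge0// exprS ler_piMr ?(ltW t00)// exprn_ile1 ?(ltW t00).
apply: (@le_trans _ _ (C0 * (4 * X * (6 ^+ m.+1 * t * (s ^+ n * s))))).
  by rewrite ler_wpM2l// ler_pM2l// mulr_gt0.
by rewrite le_eqVlt; apply/orP; left; apply/eqP; ring.
Qed.

(** The integral over the piece is the difference of those over [1, Y + d] and [1, Y], and the
    hypothesis applies at both endpoints. In the constant, 2^n pays for sqrt (v ln Z) <= 2 s, and 16
    in place of 8 shares the bound between the endpoints. *)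
Lemma odd_moment_on_piece (c Y v : R) : 0 < c ->
  (forall Z h, d <= Z -> Z `^ eps <= h <= Z `^ (1 - eps) ->
    `|\int[mu]_(x in `[1, Z]) increment R p h x ^+ n|
      <= c / (16 * M%:R * 2 ^+ n) * (Z * Num.sqrt (h * ln Z) ^+ n)) ->
  M%:R <= X -> 3 * d <= Y -> Y + d <= X ->
  dl * (Y + 2 * d) <= v <= dl * (Y + 3 * d) ->
  `|\int[mu]_(x in `]Y, Y + d]) increment R p v x ^+ n|
    <= c / (8 * M%:R) * (X * s ^+ n).
Proof.
move=> c0 HX XMM dY YX /andP[vlo vhi].
have d1 : 1 <= d by rewrite -(divff (lt0r_neq0 M0)) ler_pM2r ?invr_gt0.
have [dY' Y0 Y1 YYd YdX] : [/\ d <= Y, 0 < Y, 1 <= Y, Y <= Y + d & Y <= X].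
  by split; lra.
have vY : v <= 2 * (dl * Y).
  apply: (le_trans vhi); rewrite [leRHS]mulrCA ler_pM2l//.
  by lra.
have vd : dl * d <= v.
  apply: le_trans vlo; rewrite ler_pM2l//.
  by move: d0 => ?; lra.
have v0 : 0 < v by apply: lt_le_trans vd; exact: mulr_gt0.
have vX : v <= 2 * (dl * X) by apply: (le_trans vY); rewrite !ler_pM2l.
have dld := delta_mul_ge R eps eps1 X dl M%:R eps10 X1 M3 XM dl_lo.
have dlY := delta_mul_sub_le R eps X dl eps0 X1 dl_hi.
have half Z : Y <= Z -> Z <= X ->
    `|\int[mu]_(x in `[1, Z]) increment R p v x ^+ n|
      <= c / (8 * M%:R) * (X * s ^+ n) / 2.
  move=> YZ ZX; have Z1 : 1 <= Z by exact: le_trans YZ.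
  have Z0 : 0 < Z by exact: lt_le_trans Z1.
  have Zv : Z `^ eps <= v.
    apply: le_trans vd; apply: le_trans dld.
    rewrite ge0_ler_powR ?nnegrE ?(ltW eps0) ?(ltW Z0) ?mulr_ge0 ?(ltW X0)//.
    by apply: (le_trans ZX); rewrite ler_peMl ?(ltW X0)// ler1n.
  have vZ : v <= Z `^ (1 - eps).
    apply: le_trans (dlY Z Z0 ZX); apply: (le_trans vY).
    by rewrite !ler_pM2l.
  have Zhr : Z `^ eps <= v <= Z `^ (1 - eps) by rewrite Zv.
  apply: (le_trans (HX _ _ (le_trans dY' YZ) Zhr)).
  have LZ : ln Z <= ln X by rewrite ler_ln ?posrE.
  have LZ0 : 0 <= ln Z by rewrite ln_ge0.
  have sv : Num.sqrt (v * ln Z) <= 2 * s.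
    rewrite -(@ler_pXn2r _ 2) ?nnegrE ?sqrtr_ge0 ?mulr_ge0 ?(ltW s0)//.
    rewrite sqr_sqrtr ?mulr_ge0 ?(ltW v0)// exprMn s2.
    apply: (@le_trans _ _ (2 * (dl * X) * ln X)); first by rewrite ler_pM// ltW.
    by rewrite -mulrA ler_pM2r// -natrX ler_nat.
  apply: (@le_trans _ _ (c / (16 * M%:R * 2 ^+ n) * (X * (2 * s) ^+ n))).
    rewrite ler_pM2l; last by rewrite divr_gt0// mulr_gt0 ?exprn_gt0// mulr_gt0.
    rewrite ler_pM ?exprn_ge0 ?sqrtr_ge0 ?(ltW Z0)//.
    by rewrite lerXn2r// nnegrE ?sqrtr_ge0 ?mulr_ge0 ?(ltW s0).
  rewrite le_eqVlt exprMn; apply/orP; left; apply/eqP.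
  have : 2 ^+ n != 0 :> R by rewrite expf_neq0.
  move: (2 ^+ n) (s ^+ n) (lt0r_neq0 M0) => u w Mn0 un0.
  by field; rewrite ?un0 ?Mn0.
rewrite loc_bounded_Rintegral_split//; last exact/loc_boundedX/loc_bounded_increment.
apply: (le_trans (ler_normB _ _)).
by rewrite [leRHS]splitr lerD// half.
Qed.

End transfer_bounds.

(** * Assembly and application to psi *)

Lemma moment_transfer (R : realType) (p : R -> R) (eps eps1 C0 : R) (m : nat) :
  {homo p : x y / x <= y} ->
  0 < eps -> eps <= 1 / 2 -> 0 <= eps1 -> 0 < C0 ->
  (\forall X \near +oo, forall h : R, X `^ eps <= h <= X `^ (1 - eps) ->
    \int[@lebesgue_measure R]_(x in `[1, X]) increment R p h x ^+ m.+1.*2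
      <= C0 * (X * (h * ln X) ^+ m.+1)) ->
  (forall c : R, 0 < c -> \forall X \near +oo, forall h : R,
    X `^ eps <= h <= X `^ (1 - eps) ->
    `|\int[@lebesgue_measure R]_(x in `[1, X]) increment R p h x ^+ m.*2.+1|
      <= c * (X * Num.sqrt (h * ln X) ^+ m.*2.+1)) ->
  forall c : R, 0 < c -> \forall X \near +oo, forall dl : R,
    X `^ (- 1 + 2 * eps + 2 * eps1) <= dl <= X `^ (- eps) / 2 ->
    `|\int[@lebesgue_measure R]_(x in `[1, X])
        increment R p (dl * x) x ^+ m.*2.+1|
      <= c * (X * Num.sqrt (dl * X * ln X) ^+ m.*2.+1).
Proof.
move=> ndp eps0 eps_small eps10 C00 Heven Hodd c c0.
have C20 : 0 < 4 * 6 ^+ m.+1 * C0 by rewrite mulr_gt0// mulr_gt0// exprn_gt0.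
have [M M3n HM] := odd_moment_mul_lt R p _ c m ndp C20 c0.
have M3 : 3 <= M%:R :> R by rewrite ler_nat.
have M0 : 0 < M%:R :> R by exact: lt_le_trans M3.
have c10 : 0 < c / (16 * M%:R * 2 ^+ m.*2.+1).
  by rewrite divr_gt0// mulr_gt0 ?exprn_gt0// mulr_gt0.
(* Explicit thresholds are extracted because the hypotheses are applied at all Z >= X / M and at 4
   X, not at X itself. *)
have [X1 [X1r HX1]] := Hodd _ c10.
have [X2 [X2r HX2]] := Heven.
near=> X => dl /andP[dl_lo dl_hi].
have XMX1 : M%:R * X1 < X by near: X; apply: nbhs_pinfty_gt; exact: num_real.
have XX2 : X2 < X by near: X; exact: nbhs_pinfty_gt.
have X4 : 4 <= X by near: X; apply: nbhs_pinfty_ge; exact: num_real.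
have XMM : M%:R <= X by near: X; apply: nbhs_pinfty_ge; exact: num_real.
have Xe : expR 1 <= X by near: X; apply: nbhs_pinfty_ge; exact: num_real.
have X1' : 1 <= X by apply: le_trans X4; rewrite ler1n.
have X0 : 0 < X by exact: lt_le_trans X1'.
have XM : 4 `^ eps * M%:R <= X `^ eps.
  have XM' : (4 `^ eps * M%:R) `^ eps^-1 <= X.
    by near: X; apply: nbhs_pinfty_ge; exact: num_real.
  rewrite -[leLHS]powRr1 ?mulr_ge0 ?powR_ge0//.
  rewrite -(mulVf (lt0r_neq0 eps0)) powRrM.
  by rewrite ge0_ler_powR ?nnegrE ?powR_ge0 ?(ltW eps0) ?(ltW X0).
have dl0 := delta_gt0 R eps eps1 X dl X1' dl_lo.
have dl1 : dl <= 1.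
  apply: (le_trans (delta_le R eps X dl eps0 X1' dl_hi)).
  by rewrite ler_pdivrMr// mul1r ler1n.
have s0 : 0 < Num.sqrt (dl * X * ln X).
  by rewrite sqrtr_gt0 mulr_gt0 ?mulr_gt0// ln_gt0//.
apply: HM => //.
- move=> t h t0 t1 hr.
  apply: (@even_moment_at_4X R p eps eps1 X dl m M) => //; first exact: ltW.
  by apply: HX2; apply: (lt_le_trans XX2); rewrite ler_peMl ?(ltW X0)// ler1n.
- move=> Y v YM YX hv.
  apply: (@odd_moment_on_piece R p eps eps1 X dl m M) => // Z h dZ hr.
  apply: HX1 => //; apply: lt_le_trans dZ.
  by rewrite ltr_pdivlMr// mulrC.
Unshelve. all: by end_near.
Qed.

Theorem theorem3 (R : realType) (RH : RiemannHypothesis R)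
    (eps : R) (eps_gt0 : 0 < eps)
    (even_moments : exists A B C : R, [/\ 1 < A, 1 < B &
      \forall X \near +oo, forall (k : nat) (h : R),
        (0 < k)%N -> ~~ odd k ->
        X `^ eps <= h <= X `^ (1 - eps) ->
        `| \int[@lebesgue_measure R]_(x in `[1, X])
             (chebyshev_psi (x + h) - chebyshev_psi x - h) ^+ k
           - Gamma (k%:R + 1) / (Gamma (k%:R / 2 + 1) * 2 `^ (k%:R / 2))
             * X * h `^ (k%:R / 2) * ln (X / h) `^ (k%:R / 2) |
        <= C * (A `^ (B ^+ k) * X * h `^ (k%:R / 2)
                * ln X `^ (k%:R / 2 - 1))])
    (n : nat) (n_gt0 : (0 < n)%N) (n_odd : odd n)
    (odd_moment : unif_littleo
      (fun X : R => X `^ eps) (fun X : R => X `^ (1 - eps))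
      (fun X h : R => \int[@lebesgue_measure R]_(x in `[1, X])
         (chebyshev_psi (x + h) - chebyshev_psi x - h) ^+ n)
      (fun X h : R => X * h `^ (n%:R / 2) * ln X `^ (n%:R / 2))) :
  exists eps1 : R,
    [/\ 0 < eps1,
        (* the range of delta below is nonempty for large X whenever eps
           leaves room for this *)
        3 * eps < 1 -> 3 * eps + 2 * eps1 < 1 &
        unif_littleo
          (fun X : R => X `^ (- 1 + 2 * eps + 2 * eps1))
          (fun X : R => X `^ (- eps) / 2)
          (fun X delta : R => \int[@lebesgue_measure R]_(x in `[1, X])
             (chebyshev_psi (x + delta * x) - chebyshev_psi x
              - delta * x) ^+ n)
          (fun X delta : R => X `^ (n%:R / 2 + 1) * delta `^ (n%:R / 2)
             * ln (1 / delta) `^ (n%:R / 2))].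
Proof.
have ndp := chebyshev_psi_nondecreasing R.
(* For eps >= 1/3 the range of dl is empty as soon as X >= 1. *)
have [eps_ge|eps_lt] := leP 1 (3 * eps).
  exists 1; split; [exact: ltr01|by move=> ?; lra|].
  move=> c c0; near=> X => dl /andP[dlo dhi].
  have X1 : 1 <= X by near: X; apply: nbhs_pinfty_ge; exact: num_real.
  have : X `^ (- 1 + 2 * eps + 2 * 1) <= X `^ (- eps) / 2 by exact: le_trans dhi.
  rewrite leNgt => /negP[]; apply: (@lt_le_trans _ _ (X `^ (- eps))).
    by rewrite ltr_pdivrMr// ltr_pMr ?ltr1n// powR_gt0// (lt_le_trans _ X1).
  by rewrite ler_powR//; lra.
(* With this choice 3 eps + 2 eps1 = (1 + 3 eps) / 2 < 1. *)
exists ((1 - 3 * eps) / 4); split; [by lra|by move=> _; lra|].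
move: n_gt0 odd_moment; rewrite -(odd_double_half n) n_odd add1n.
move: (n./2) => m _ odd_moment c c0.
have [C0 C00 HC0] := even_moment_le R (@chebyshev_psi R) eps eps_gt0
  (fun k => Gamma (k%:R + 1) / (Gamma (k%:R / 2 + 1) * 2 `^ (k%:R / 2)))
  even_moments m.+1 isT.
have powR_half (t : R) : 0 <= t ->
    t `^ (m.*2.+1%:R / 2) = Num.sqrt t ^+ m.*2.+1.
  by move=> t0; rewrite mulrC powRrM powR12_sqrt// powR_mulrn// sqrtr_ge0.
set a : R := m.*2.+1%:R / 2 in odd_moment powR_half *.
have a0 : 0 <= a by rewrite divr_ge0.
have odd_moment' (c' : R) : 0 < c' -> \forall X \near +oo, forall h : R,
    X `^ eps <= h <= X `^ (1 - eps) ->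
    `|\int[@lebesgue_measure R]_(x in `[1, X])
        increment R (@chebyshev_psi R) h x ^+ m.*2.+1|
      <= c' * (X * Num.sqrt (h * ln X) ^+ m.*2.+1).
  move=> c'0; move: (odd_moment c' c'0); apply: filter_app; near=> X => H h hX.
  have X1 : 1 <= X by near: X; apply: nbhs_pinfty_ge; exact: num_real.
  have h0 : 0 <= h by case/andP: hX => /(le_trans _) + _; apply; exact: powR_ge0.
  apply: (le_trans (H h hX)); rewrite ger0_norm; last first.
    by rewrite !mulr_ge0 ?powR_ge0// (le_trans _ X1).
  by rewrite -mulrA -powRM ?ln_ge0// powR_half// mulr_ge0// ln_ge0.
(* As dl <= X^(-eps), ln X is at most ln (1 / dl) / eps; the factor eps^a compensates for replacing
   ln X by ln (1 / dl). *)
have cc0 : 0 < c * eps `^ a by rewrite mulr_gt0// powR_gt0.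
have eps_half : eps <= 1 / 2 by lra.
have eps1_ge0 : 0 <= (1 - 3 * eps) / 4 by lra.
have := moment_transfer R _ eps ((1 - 3 * eps) / 4) C0 m ndp eps_gt0 eps_half
  eps1_ge0 C00 HC0 odd_moment' _ cc0.
apply: filter_app; near=> X => H dl hdl.
have X1 : 1 <= X by near: X; apply: nbhs_pinfty_ge; exact: num_real.
have X0 : 0 < X by exact: lt_le_trans X1.
apply: (le_trans (H dl hdl)).
case/andP: hdl => dlo dhi.
have dl0 := delta_gt0 R eps _ X dl X1 dlo.
have lnd : eps * ln X <= ln (1 / dl).
  rewrite -ln_powR ler_ln ?posrE ?powR_gt0 ?divr_gt0//.
  rewrite mul1r -[leLHS]invrK lef_pV2 ?posrE ?invr_gt0 ?powR_gt0//.
  rewrite -powRN; apply: (le_trans dhi).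
  by rewrite ler_pdivrMr// ler_peMr ?powR_ge0// ler1n.
have lX0 : 0 <= ln X by exact: ln_ge0.
have ld0 : 0 <= ln (1 / dl).
  by apply: le_trans lnd; rewrite mulr_ge0// ltW.
rewrite ger0_norm ?mulr_ge0 ?powR_ge0// -mulrA ler_pM2l//.
rewrite -powR_half ?mulr_ge0 ?(ltW dl0) ?(ltW X0)//.
rewrite powRD ?(gt_eqF X0) ?implybT// powRr1 ?(ltW X0)//.
rewrite mulrCA [X `^ a * X]mulrC -!mulrA ler_pM2l//.
(* Once c and X are cancelled, both sides are a-th powers, and comparing their bases leaves
   [lnd]. *)
rewrite -!powRM ?mulr_ge0 ?(ltW dl0) ?(ltW X0) ?(ltW eps_gt0)//.
rewrite ge0_ler_powR ?nnegrE ?mulr_ge0 ?(ltW dl0) ?(ltW X0) ?(ltW eps_gt0)//.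
by rewrite mulrCA [leRHS]mulrCA ler_pM2l// mulrCA ler_pM2l.
Unshelve. all: by end_near.
Qed.
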